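(* Let $k$ be a field, $n\ge1$, $\mathfrak{G}=E^n(k)_{Lie}$, and let $\phi\in H^{n+1}(\mathfrak{G},k)$ be the Tate extension class (all defined in the context). Let $P_1^+,\ldots,P_n^+\in E^n(k)$ be a system of good idempotents and $P_i^-=1-P_i^+$. Then, whenever $f_0,\ldots,f_n\in\mathfrak{G}$ are such that $f_0\otimes f_1\wedge\ldots\wedge f_n$ is a $\mathfrak{G}$-valued Lie cycle (a cycle in the Chevalley–Eilenberg complex of $\mathfrak{G}$ with coefficients in the adjoint module $\mathfrak{G}$), $$\phi(f_0\wedge f_1\wedge\ldots\wedge f_n)=\operatorname{tr}\sum_{\pi\in\mathfrak{S}_n}\operatorname{sgn}(\pi)\sum_{\gamma_1,\ldots,\gamma_n\in\{\pm\}}(-1)^{\gamma_1+\cdots+\gamma_n}\big(P_1^{-\gamma_1}\operatorname{ad}(f_{\pi(1)})P_1^{\gamma_1}\big)\cdots\big(P_n^{-\gamma_n}\operatorname{ad}(f_{\pi(n)})P_n^{\gamma_n}\big)f_0 .$$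
   Context: For an associative algebra $A$, $A_{Lie}$ denotes $A$ with bracket $[a,b]=ab-ba$; $(-1)^{\pm}=\pm1$. In the formula, $P_i^{\pm}$ acts on $A$ by left multiplication and $\operatorname{ad}(f)g=[f,g]$, so each product of brackets is an operator applied to $f_0$; $\operatorname{tr}$ means $\tau$ below. Infinite matrix algebras. For an associative $k$-algebra $R$ let $E(R)$ be the algebra of matrices $(\phi_{ij})_{i,j\in\mathbf{Z}}$, $\phi_{ij}\in R$, for which there is $K$ with $\phi_{ij}=0$ whenever $|i-j|>K$. Let $I^{+}(R)$ (resp. $I^{-}(R)$) be the two-sided ideal of those $\phi\in E(R)$ for which there is $B$ with $\phi_{ij}=0$ for all $i<B$ (resp. for all $j>B$); $I^{0}(R)=I^{+}(R)\cap I^{-}(R)$ consists of matrices with finitely many nonzero entries, and $\operatorname{tr}\phi=\sum_i\phi_{ii}\in R$ on $I^0(R)$. Put $A=E^{n}(k)=E(\cdots E(k))$. Let $I_i^{\pm}\subseteq A$ be the ideal obtained by applying $E$ in all places except the $i$-th (counted from the inside), where $I^{\pm}$ is applied. Put $I_i^0=I_i^+\cap I_i^-$, $I_{\operatorname{tr}}=I_1^0\cap\cdots\cap I_n^0$, and let $\tau:I_{\operatorname{tr}}\to k$ be the $n$-fold iterated trace; it vanishes on $[I_{\operatorname{tr}},A]$. A system of good idempotents: pairwise commuting elements $P_i^+\in A$ ($1\le i\le n$) with $(P_i^+)^2=P_i^+$, $P_i^+A\subseteq I_i^+$, and $P_i^-A\subseteq I_i^-$ where $P_i^-=1_A-P_i^+$.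 $\mathfrak{G}$-valued cycles: $C(\mathfrak{G})_r=\mathfrak{G}\otimes\bigwedge^r\mathfrak{G}$ with differential $\delta(f_0\otimes f_1\wedge\cdots\wedge f_r)=\sum_{i=1}^r(-1)^i[f_0,f_i]\otimes f_1\wedge\cdots\widehat{f_i}\cdots\wedge f_r+\sum_{1\le i<j\le r}(-1)^{i+j+1}f_0\otimes[f_i,f_j]\wedge f_1\cdots\widehat{f_i}\cdots\widehat{f_j}\cdots\wedge f_r$. The class $\phi$. For a Lie ideal $\mathfrak{j}\subseteq\mathfrak{G}$ let $CE(\mathfrak{j})_0=k$ and, for $r\ge1$, $CE(\mathfrak{j})_r=\mathfrak{j}\wedge\bigwedge^{r-1}\mathfrak{G}\subseteq\bigwedge^r\mathfrak{G}$ (span of all $j\wedge g_1\wedge\cdots\wedge g_{r-1}$, $j\in\mathfrak{j}$), with differential $\delta(f_0\wedge\cdots\wedge f_r)=\sum_{0\le i<j\le r}(-1)^{i+j}[f_i,f_j]\wedge f_0\wedge\cdots\widehat{f_i}\cdots\widehat{f_j}\cdots\wedge f_r$. $CE(\mathfrak{G})_\bullet$ computes $H_\bullet(\mathfrak{G},k)$. For $s\in\{+,-,0\}^n$ put $\deg(s)=1+\#\{i: s_i=0\}$. Let ${}^{\wedge}T^0_\bullet=CE(\mathfrak{G})_\bullet$ and, for $1\le p\le n+1$, ${}^{\wedge}T^p_\bullet=\bigoplus_{\deg(s)=p}\bigcap_{i=1}^n X_i^{s_i}$, where $X_i^{\pm}=CE(I_i^{\pm})_\bullet$, $X_i^0=CE(I_i^+)_\bullet\cap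 CE(I_i^-)_\bullet$. Define $\partial:{}^{\wedge}T^{p}\to{}^{\wedge}T^{p-1}$ for $p\ge2$ by $(\partial f)_{s_1\ldots s_n}=\sum_{\{i: s_i=\pm\}}(-1)^{\#\{j>i: s_j=0\}}f_{s_1\ldots0\ldots s_n}$ ($0$ in the $i$-th place), and for $p=1$ by $\partial f=\sum_{s\in\{+,-\}^n}(-1)^{s_1+\cdots+s_n}f_s$. This is an exact complex of complexes; its bicomplex spectral sequence with $E^1_{p,q}=H_q({}^{\wedge}T^p_\bullet)$ converges to $0$, and $d_{n+1}:E^{n+1}_{n+1,1}\to E^{n+1}_{0,n+1}$ is an isomorphism. Let $\rho_2:H_{n+1}(\mathfrak{G},k)=E^1_{0,n+1}\to E^{n+1}_{0,n+1}$ and $\rho_1:E^{n+1}_{n+1,1}\to E^1_{n+1,1}=I_{\operatorname{tr}}/[I_{\operatorname{tr}},\mathfrak{G}]$ be the edge maps; put $\operatorname{res}_*=\tau\circ\rho_1\circ(d_{n+1})^{-1}\circ\rho_2$. Concretely (this fixes signs), for a cycle $\theta_0$ choose $\theta_i\in{}^{\wedge}T^i_{n+2-i}$ with $\partial\theta_1=\theta_0$, $\partial\theta_{i+1}=\delta\theta_i$ for $1\le i\le n$; then $\operatorname{res}_*[\theta_0]=\tau(\theta_{n+1})$. The Tate extension class $\phi=\operatorname{res}^*(1)\in H^{n+1}(\mathfrak{G},k)\cong H_{n+1}(\mathfrak{G},k)^*$ corresponds to $\operatorname{res}_*$, i.e. $\phi(z)=\operatorname{res}_*[z]$ for cycles $z$.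 *)

(* Defs.v *)
From HB Require Import structures.
From mathcomp Require Import all_boot all_order all_algebra all_fingroup.
From mathcomp Require Import generic_quotient ring_quotient zify.
From mathcomp.multinomials Require Import freeg.
From mathcomp Require Import boolp classical_sets functions cardinality fsbigop.

Set Implicit Arguments.
Unset Strict Implicit.
Unset Printing Implicit Defensive.

Import Order.TTheory GRing.Theory Num.Theory.
Local Open Scope classical_set_scope.
Local Open Scope quotient_scope.
Local Open Scope ring_scope.

Section InfiniteMatrices.

Definition banded (R : nzRingType) (phi : int -> int -> R) : Prop :=
  exists K : nat, forall i j : int, (K < `|i - j|)%N -> phi i j = 0.

Record imat (R : nzRingType) := IMat {
  entry :> int -> int -> R;
  _ : `[< banded entry >] }.

HB.instance Definition _ (R : nzRingType) := [isSub for @entry R].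
HB.instance Definition _ (R : nzRingType) := [Choice of imat R by <:].

Variable R : nzRingType.
Implicit Types phi psi chi : imat R.

Lemma imatP phi psi : (forall i j, phi i j = psi i j) -> phi = psi.
Proof. by move=> h; apply/val_inj/funext => i; apply/funext => j; exact: h. Qed.

Lemma imat_banded phi : banded phi.
Proof. by apply/asboolP; case: phi. Qed.

Definition mk_imat (f : int -> int -> R) (h : banded f) : imat R :=
  IMat (asboolT h).

Fact imat0_subproof : banded (fun _ _ : int => 0 : R).
Proof. by exists 0%N. Qed.

Fact imat1_subproof : banded (fun i j : int => (i == j)%:R : R).
Proof.
exists 0%N => i j h; case: eqVneq h => // ->.
by rewrite subrr.
Qed.

Fact imatN_subproof phi : banded (fun i j => - phi i j).
Proof. by have [K h] := imat_banded phi; exists K => i j /h ->; rewrite oppr0. Qed.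

Fact imatD_subproof phi psi : banded (fun i j => phi i j + psi i j).
Proof.
have [K h] := imat_banded phi; have [L g] := imat_banded psi.
by exists (K + L)%N => i j KL; rewrite h ?g ?addr0 //; lia.
Qed.

(* [\sum_(l \in _)] sums over the support, which is finite here because phi is
   banded. *)
Fact imatM_subproof phi psi :
  banded (fun i j => \sum_(l \in [set: int]) phi i l * psi l j).
Proof.
have [K h] := imat_banded phi; have [L g] := imat_banded psi.
exists (K + L)%N => i j KL; apply: fsbig1 => l _.
have [Kl|lK] := ltnP K `|i - l|%N; first by rewrite h ?mul0r.
by rewrite g ?mulr0 //; lia.
Qed.

Definition imat0 := mk_imat imat0_subproof.
Definition imat1 := mk_imat imat1_subproof.
Definition imatN phi := mk_imat (imatN_subproof phi).
Definition imatD phi psi := mk_imat (imatD_subproof phi psi).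
Definition imatM phi psi := mk_imat (imatM_subproof phi psi).

Fact imatDA : associative imatD.
Proof. by move=> *; apply: imatP => i j /=; rewrite addrA. Qed.
Fact imatDC : commutative imatD.
Proof. by move=> *; apply: imatP => i j /=; rewrite addrC. Qed.
Fact imat0D : left_id imat0 imatD.
Proof. by move=> *; apply: imatP => i j /=; rewrite add0r. Qed.
Fact imatND : left_inverse imat0 imatN imatD.
Proof. by move=> *; apply: imatP => i j /=; rewrite addNr. Qed.

HB.instance Definition _ :=
  GRing.isZmodule.Build (imat R) imatDA imatDC imat0D imatND.

(* [win i K] enumerates the integers at distance at most K from i. *)
Definition win (i : int) (K : nat) : seq int :=
  [seq i - K%:Z + m%:Z | m <- iota 0 (K + K).+1].

Lemma win_uniq i K : uniq (win i K).
Proof. by rewrite map_inj_uniq ?iota_uniq // => m m'; lia. Qed.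

Lemma mem_win i K l : (l \in win i K) = (`|i - l| <= K)%N.
Proof.
apply/mapP/idP => [[m]|lK]; first by rewrite mem_iota => ? ->; lia.
by exists (absz (l - i + K%:Z)); rewrite ?mem_iota; lia.
Qed.

Lemma imatM_win phi psi i j K : (forall l, (K < `|i - l|)%N -> phi i l = 0) ->
  imatM phi psi i j = \sum_(l <- win i K) phi i l * psi l j.
Proof.
move=> h /=; rewrite (fsbigE (win i K)) ?win_uniq //= => [|l _].
  by apply/eq_bigl => l; rewrite in_setT.
by rewrite mem_win -ltnNge => /h ->; rewrite mul0r.
Qed.

Lemma imatM_winr phi psi i j s : uniq s ->
  (forall l, l \notin s -> psi l j = 0) ->
  imatM phi psi i j = \sum_(l <- s) phi i l * psi l j.
Proof.
move=> us h /=; rewrite (fsbigE s) //= => [|l _ /h ->]; last by rewrite mulr0.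
by apply/eq_bigl => l; rewrite in_setT.
Qed.

Fact imatMA : associative imatM.
Proof.
move=> a b c; apply: imatP => i j.
have [K h] := imat_banded a; have [L g] := imat_banded c.
rewrite (@imatM_win _ _ _ _ K); last by move=> l /h.
rewrite (@imatM_winr _ _ _ _ (win j L)) ?win_uniq //; last first.
  by move=> l; rewrite mem_win -ltnNge => ?; apply: g; lia.
under eq_bigr => l _.
  rewrite (@imatM_winr _ _ _ _ (win j L)) ?win_uniq //; last first.
    by move=> m; rewrite mem_win -ltnNge => ?; apply: g; lia.
  rewrite mulr_sumr; over.
rewrite exchange_big /=; apply: eq_bigr => m _.
rewrite -[X in X * _]/(imatM a b i m) (@imatM_win _ _ _ _ K) ?mulr_suml; last by move=> l /h.
by apply: eq_bigr => l _; rewrite mulrA.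
Qed.

Fact imat1M : left_id imat1 imatM.
Proof.
move=> a; apply: imatP => i j; rewrite (@imatM_win _ _ _ _ 0%N) => [|l /=].
  by rewrite /win big_seq1 /= subr0 addr0 eqxx mul1r.
by case: eqVneq => // ->; rewrite subrr.
Qed.

Fact imatM1 : right_id imat1 imatM.
Proof.
move=> a; apply: imatP => i j; rewrite (@imatM_winr _ _ _ _ [:: j]) //=.
  by rewrite big_seq1 eqxx mulr1.
by move=> l; rewrite inE => /negPf ->.
Qed.

Fact imatMDl : left_distributive imatM imatD.
Proof.
move=> a b c; apply: imatP => i j; have [L g] := imat_banded c.
have w l : l \notin win j L -> c l j = 0.
  by rewrite mem_win -ltnNge => ?; apply: g; lia.
rewrite -[RHS]/(imatM a c i j + imatM b c i j).
rewrite !(imatM_winr _ _ (win_uniq j L)) // -big_split /=.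
by apply: eq_bigr => l _; rewrite mulrDl.
Qed.

Fact imatMDr : right_distributive imatM imatD.
Proof.
move=> a b c; apply: imatP => i j; have [K h] := imat_banded a.
have w l : (K < `|i - l|)%N -> a i l = 0 by exact: h.
rewrite -[RHS]/(imatM a b i j + imatM a c i j).
rewrite !(imatM_win _ _ w) // -big_split /=.
by apply: eq_bigr => l _; rewrite mulrDr.
Qed.

Fact imat1_neq0 : imat1 != 0.
Proof.
apply/eqP => /(congr1 (fun a : imat R => a 0 0)) /= /eqP.
by rewrite oner_eq0.
Qed.

HB.instance Definition _ := GRing.Zmodule_isNzRing.Build (imat R)
  imatMA imat1M imatM1 imatMDl imatMDr imat1_neq0.

End InfiniteMatrices.

Section InfiniteMatrixAlgebra.
Variables (k : fieldType) (R : algType k).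
Implicit Types (phi : imat R) (a : k).

Fact imatZ_subproof a phi : banded (fun i j => a *: phi i j).
Proof. by have [K h] := imat_banded phi; exists K => i j /h ->; rewrite scaler0. Qed.

Definition imatZ a phi : imat R := mk_imat (imatZ_subproof a phi).

Fact imatZA a b phi : imatZ a (imatZ b phi) = imatZ (a * b) phi.
Proof. by apply: imatP => i j /=; rewrite scalerA. Qed.
Fact imat1Z : left_id 1 imatZ.
Proof. by move=> phi; apply: imatP => i j /=; rewrite scale1r. Qed.
Fact imatZDr : right_distributive imatZ +%R.
Proof. by move=> *; apply: imatP => i j /=; rewrite scalerDr. Qed.
Fact imatZDl phi : {morph imatZ^~ phi : a b / a + b}.
Proof. by move=> *; apply: imatP => i j /=; rewrite scalerDl. Qed.

HB.instance Definition _ := GRing.Zmodule_isLmodule.Build k (imat R)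
  imatZA imat1Z imatZDr imatZDl.

Fact imatZAl a phi psi : a *: (phi * psi) = (a *: phi) * psi :> imat R.
Proof.
apply: imatP => i j; have [K h] := imat_banded phi.
have w l : (K < `|i - l|)%N -> phi i l = 0 by exact: h.
rewrite -[LHS]/(a *: imatM phi psi i j) (imatM_win _ _ w).
rewrite -[RHS]/(imatM (a *: phi) psi i j) (@imatM_win _ _ _ _ _ K).
  by rewrite scaler_sumr; apply: eq_bigr => l _; rewrite -scalerAl.
by move=> l /w /= ->; rewrite scaler0.
Qed.

HB.instance Definition _ := GRing.Lmodule_isLalgebra.Build k (imat R) imatZAl.

Fact imatZAr a phi psi : a *: (phi * psi) = phi * (a *: psi) :> imat R.
Proof.
apply: imatP => i j; have [K h] := imat_banded phi.
have w l : (K < `|i - l|)%N -> phi i l = 0 by exact: h.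
rewrite -[LHS]/(a *: imatM phi psi i j) (imatM_win _ _ w).
rewrite -[RHS]/(imatM phi (a *: psi) i j) (imatM_win _ _ w).
by rewrite scaler_sumr; apply: eq_bigr => l _; rewrite -scalerAr.
Qed.

HB.instance Definition _ := GRing.Lalgebra_isAlgebra.Build k (imat R) imatZAr.

End InfiniteMatrixAlgebra.

Section IteratedMatrices.
Variable k : fieldType.

Fixpoint Epow (n : nat) : algType k :=
  if n is m.+1 then (imat (Epow m) : algType k) else (k^o : algType k).

(* I^+(R) if s is true, I^-(R) if s is false. *)
Definition Ipm (R : nzRingType) (s : bool) : set (imat R) :=
  [set phi : imat R | exists B : int, forall i j : int,
     (if s then i < B else B < j) -> phi i j = 0].

Definition Esub (R : nzRingType) (J : set R) : set (imat R) :=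
  [set phi : imat R | forall i j : int, J (phi i j)].

(* [Iat n i s] is the ideal I_{i+1}^s of E^n(k): places are numbered from 0
   here, and place n-1 is the outermost one. *)
Fixpoint Iat (n i : nat) (s : bool) : set (Epow n) :=
  match n return set (Epow n) with
  | 0 => setT
  | m.+1 => if i == m then @Ipm (Epow m) s else @Esub (Epow m) (@Iat m i s)
  end.

Definition Itr (n : nat) : set (Epow n) :=
  [set x | forall (i : 'I_n) (s : bool), Iat i s x].

(* The iterated trace; only its values on [Itr n] are meaningful. At each step
   the sum of the diagonal entries has finite support on [Itr n], and
   [\sum_(i \in _)] is 0 when the support is infinite. *)
Fixpoint tau (n : nat) : Epow n -> k :=
  match n return Epow n -> k with
  | 0 => fun x => x
  | m.+1 => fun phi : imat (Epow m) => tau (\sum_(i \in [set: int]) phi i i)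
  end.

End IteratedMatrices.
Arguments Itr : clear implicits.

Section Quotients.
Variables (k : fieldType) (V : lmodType k).
Implicit Types (S : set V) (a : k).

Definition lspan S : set V :=
  [set v | exists2 l : seq (k * V),
     forall x, x \in l -> S x.2 & v = \sum_(x <- l) x.1 *: x.2].

Definition lspan_mem S : {pred V} := fun v => `[< lspan S v >].

Lemma lspan_memP S v : reflect (lspan S v) (v \in lspan_mem S).
Proof. exact: asboolP. Qed.

Lemma lspan0 S : lspan S 0.
Proof. by exists [::]; rewrite ?big_nil. Qed.

Lemma lspanD S u v : lspan S u -> lspan S v -> lspan S (u + v).
Proof.
move=> [l lS ->] [m mS ->]; exists (l ++ m); last by rewrite big_cat.
by move=> x; rewrite mem_cat => /orP[/lS|/mS].
Qed.

Lemma lspanZ S a v : lspan S v -> lspan S (a *: v).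
Proof.
move=> [l lS ->]; exists [seq (a * x.1, x.2) | x <- l].
  by move=> _ /mapP[x /lS ? ->].
by rewrite big_map scaler_sumr; apply: eq_bigr => x _; rewrite scalerA.
Qed.

Lemma sub_lspan S v : S v -> lspan S v.
Proof.
move=> Sv; exists [:: (1, v)]; last by rewrite big_seq1 scale1r.
by move=> x; rewrite inE => /eqP ->.
Qed.

Fact lspan_zmod_closed S : zmod_closed (lspan_mem S).
Proof.
split=> [|u v /lspan_memP uS /lspan_memP vS]; apply/lspan_memP.
  exact: lspan0.
by apply: lspanD uS _; rewrite -scaleN1r; exact: lspanZ.
Qed.

HB.instance Definition _ S :=
  GRing.isZmodClosed.Build V (lspan_mem S) (lspan_zmod_closed S).

Definition quotm S : Type := Quotient.quot (lspan_mem S).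

HB.instance Definition _ S := GRing.Zmodule.on (quotm S).

Definition qpi S (v : V) : quotm S := \pi_(Quotient.quot (lspan_mem S)) v.
Definition qrepr S (x : quotm S) : V := repr (x : Quotient.quot (lspan_mem S)).
Definition qscale S a (x : quotm S) : quotm S := qpi S (a *: qrepr x).

Lemma qreprK S (x : quotm S) : qpi S (qrepr x) = x.
Proof. exact: reprK. Qed.

Lemma qpi_eq S u v : qpi S u = qpi S v <-> lspan S (u - v).
Proof.
split=> [/eqP|/lspan_memP h].
  by rewrite -Quotient.idealrBE => /lspan_memP.
by apply/eqP; rewrite -Quotient.idealrBE.
Qed.

Lemma qpiD S u v : qpi S (u + v) = qpi S u + qpi S v.
Proof. exact: Quotient.pi_add. Qed.

Lemma qpiZ S a v : qscale a (qpi S v) = qpi S (a *: v).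
Proof.
apply/qpi_eq; rewrite -scalerBr; apply: lspanZ.
by apply/(@qpi_eq S); rewrite qreprK.
Qed.

Fact qscaleA S a b (x : quotm S) : qscale a (qscale b x) = qscale (a * b) x.
Proof. by rewrite -[x]qreprK !qpiZ scalerA. Qed.
Fact qscale1 S : left_id 1 (@qscale S).
Proof. by move=> x; rewrite -[x]qreprK qpiZ scale1r. Qed.
Fact qscaleDr S : right_distributive (@qscale S) +%R.
Proof.
move=> a x y; rewrite -[x]qreprK -[y]qreprK -qpiD !qpiZ scalerDr.
by rewrite qpiD.
Qed.
Fact qscaleDl S (x : quotm S) : {morph (@qscale S)^~ x : a b / a + b}.
Proof. by move=> a b; rewrite -[x]qreprK !qpiZ scalerDl qpiD. Qed.

HB.instance Definition _ S := GRing.Zmodule_isLmodule.Build k (quotm S)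
  (@qscaleA S) (@qscale1 S) (@qscaleDr S) (@qscaleDl S).

Fact qpi_linear S : linear (qpi S).
Proof. by move=> a u v; rewrite qpiD -qpiZ. Qed.

HB.instance Definition _ S :=
  GRing.isLinear.Build k V (quotm S) *:%R (qpi S) (@qpi_linear S).

End Quotients.

Section Presentations.
Variables (k : fieldType) (T : choiceType) (rel : set {freeg T / k}).

Definition pres : Type := quotm rel.
HB.instance Definition _ := GRing.Lmodule.on pres.

Definition pgen (t : T) : pres := qpi rel << t >>.

(* The linear map defined by its values D on generators; it is meaningful
   only if D respects the relations, see [plift_linear] and [plift_gen]. *)
Definition plift (W : lmodType k) (D : T -> W) (x : pres) : W :=
  fglift D (qrepr x).

Lemma fglift_linear (W : lmodType k) (D : T -> W) : linear (fglift D).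
Proof.
have B : additive (fglift D) by exact: lift_is_additive.
pose BM := GRing.isAdditive.Build _ _ _ B.
pose F : {additive {freeg T / k} -> W} := HB.pack (fglift D) BM.
have E x : fglift D x = F x by [].
move=> a u v; rewrite E raddfD -!E; congr (_ + _).
rewrite -[in RHS](freeg_sumE u) -[a *: u]/(fgscale a u) /fgscale !E !raddf_sum.
apply: eq_bigr => t _.
by rewrite /= !liftU scalerA.
Qed.

Lemma fglift0 (W : lmodType k) (D : T -> W) : fglift D 0 = 0.
Proof.
have := fglift_linear D (-1) 0 0.
by rewrite scaler0 addr0 scaleN1r addNr.
Qed.

Lemma fgliftZ (W : lmodType k) (D : T -> W) a u :
  fglift D (a *: u) = a *: fglift D u.
Proof. by have := fglift_linear D a u 0; rewrite fglift0 !addr0. Qed.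

Lemma fgliftB (W : lmodType k) (D : T -> W) u v :
  fglift D (u - v) = fglift D u - fglift D v.
Proof. by have := fglift_linear D (-1) v u; rewrite !scaleN1r !(addrC (- _)). Qed.

Lemma fgliftE (W : lmodType k) (D : T -> W) u :
  fglift D u = \sum_(t <- dom u) coeff t u *: D t.
Proof.
pose BM := GRing.isLinear.Build _ _ _ _ _ (fglift_linear D).
pose F : {linear {freeg T / k} -> W} := HB.pack (fglift D) BM.
have E x : fglift D x = F x by [].
rewrite -{1}(freeg_sumE u) E raddf_sum; apply: eq_bigr => t _.
exact: liftU.
Qed.

Section Lift.
Variables (W : lmodType k) (D : T -> W).
Hypothesis Drel : forall r, rel r -> fglift D r = 0.

Lemma fglift_rel u : lspan rel u -> fglift D u = 0.
Proof.
pose BM := GRing.isLinear.Build _ _ _ _ _ (fglift_linear D).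
pose F : {linear {freeg T / k} -> W} := HB.pack (fglift D) BM.
have E x : fglift D x = F x by [].
move=> [l lS ->]; rewrite E linear_sum big_seq big1 // => x /lS /Drel xS.
by rewrite linearZ /= xS scaler0.
Qed.

Lemma plift_pi u : plift D (qpi rel u) = fglift D u.
Proof.
have := fglift_linear D (-1) u (qrepr (qpi rel u)).
rewrite !scaleN1r fglift_rel => [/esym/eqP|].
  by rewrite addrC subr_eq0 => /eqP.
by rewrite addrC; apply/qpi_eq; rewrite qreprK.
Qed.

Lemma plift_linear : linear (plift D).
Proof.
move=> a x y; rewrite -[x]qreprK -[y]qreprK -linearP !plift_pi.
exact: fglift_linear.
Qed.

Lemma plift_gen t : plift D (pgen t) = D t.
Proof. by rewrite plift_pi liftU scale1r. Qed.

End Lift.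
End Presentations.

Section Exterior.
Variables (k : fieldType) (V : lmodType k).
Implicit Types (s t : seq V) (a : k) (x y : V).

(* The tensor algebra T(V), presented on words, modulo the two-sided ideal
   generated by the squares x (x) x. *)
Definition ext_rel : set {freeg (seq V) / k} :=
  [set r : {freeg (seq V) / k} |
    (exists s t a x y,
       r = << s ++ (a *: x + y) :: t >> - a *: << s ++ x :: t >>
           - << s ++ y :: t >>)
    \/ (exists s t x, r = << s ++ x :: x :: t >>)].

Definition ext : Type := pres ext_rel.
HB.instance Definition _ := GRing.Lmodule.on ext.

Definition wedge s : ext := pgen ext_rel s.

Definition extp (r : nat) : set ext :=
  lspan [set w : ext | exists2 s, size s = r & w = wedge s].

Definition word_linear (W : lmodType k) (D : seq V -> W) :=
  forall s t a x y,
    D (s ++ (a *: x + y) :: t) = a *: D (s ++ x :: t) + D (s ++ y :: t).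
Definition word_alternating (W : lmodType k) (D : seq V -> W) :=
  forall s t x, D (s ++ x :: x :: t) = 0.

Lemma ext_rel_lift (W : lmodType k) (D : seq V -> W) :
  word_linear D -> word_alternating D ->
  forall r, ext_rel r -> fglift D r = 0.
Proof.
move=> Dl Da r.
case=> [[s [t [a [x [y ->]]]]]|[s [t [x ->]]]].
  by rewrite !fgliftB fgliftZ !liftU !scale1r Dl addrAC addrK subrr.
by rewrite liftU scale1r Da.
Qed.

Lemma wedge_linear : word_linear wedge.
Proof.
move=> s t a x y; rewrite /wedge /pgen -linearP.
apply/qpi_eq/sub_lspan; left; exists s, t, a, x, y.
by rewrite opprD addrA.
Qed.

Lemma wedge_alternating : word_alternating wedge.
Proof.
move=> s t x; rewrite /wedge /pgen -(linear0 (qpi ext_rel)).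
by apply/qpi_eq/sub_lspan; right; exists s, t, x; rewrite subr0.
Qed.

End Exterior.

Section Tensor.
Variables (k : fieldType) (V W : lmodType k).

Definition tens_rel : set {freeg (V * W) / k} :=
  [set r : {freeg (V * W) / k} |
    (exists a x y w, r = << (a *: x + y, w) >> - a *: << (x, w) >> - << (y, w) >>)
    \/ (exists a x w z,
          r = << (x, a *: w + z) >> - a *: << (x, w) >> - << (x, z) >>)].

Definition tensor : Type := pres tens_rel.
HB.instance Definition _ := GRing.Lmodule.on tensor.

Definition tens (x : V) (w : W) : tensor := pgen tens_rel (x, w).

Lemma tens_linearl w a x y : tens (a *: x + y) w = a *: tens x w + tens y w.
Proof.
rewrite /tens /pgen -linearP; apply/qpi_eq/sub_lspan; left.
by exists a, x, y, w; rewrite opprD addrA.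
Qed.

Lemma tens_linear x : linear (tens x).
Proof.
move=> a w z; rewrite /tens /pgen -linearP; apply/qpi_eq/sub_lspan; right.
by exists a, x, w, z; rewrite opprD addrA.
Qed.

HB.instance Definition _ x :=
  GRing.isLinear.Build k W tensor *:%R (tens x) (@tens_linear x).

Lemma tens_rel_lift (U : lmodType k) (D : V * W -> U) :
  (forall w, linear (fun x => D (x, w))) ->
  (forall x, linear (fun w => D (x, w))) ->
  forall r, tens_rel r -> fglift D r = 0.
Proof.
move=> Dl Dr r.
case=> [[a [x [y [w ->]]]]|[a [x [w [z ->]]]]].
  by rewrite !fgliftB fgliftZ !liftU !scale1r Dl addrAC addrK subrr.
by rewrite !fgliftB fgliftZ !liftU !scale1r Dr addrAC addrK subrr.
Qed.

End Tensor.

Section ChevalleyEilenberg.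
Variables (k : fieldType) (A : algType k).
Implicit Types (s t : seq A) (x y z : A) (J : set A).

Definition br x y : A := x * y - y * x.

(* The word s with its letter of index i omitted. *)
Definition del (i : nat) s : seq A := take i s ++ drop i.+1 s.

Definition ce_word s : ext A :=
  \sum_(j < size s) \sum_(i < size s | (i < j)%N)
     (-1) ^+ (i + j) *: wedge (br s`_i s`_j :: del i (del j s)).

Definition ce_d : ext A -> ext A := plift ce_word.

(* The letters f_1, ..., f_r of the word s have indices 0, ..., r-1, whence
   the shifted exponents. *)
Definition adj_word x s : tensor A (ext A) :=
  \sum_(i < size s) (-1) ^+ i.+1 *: tens (br x s`_i) (wedge (del i s))
  + \sum_(j < size s) \sum_(i < size s | (i < j)%N)
      (-1) ^+ (i.+1 + j.+1 + 1)
        *: tens x (wedge (br s`_i s`_j :: del i (del j s))).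

Definition adj_d : tensor A (ext A) -> tensor A (ext A) :=
  plift (fun p : A * ext A => plift (adj_word p.1) p.2).

Definition ce (J : set A) (r : nat) : set (ext A) :=
  if r is r'.+1
  then lspan [set w : ext A | exists x g,
                 [/\ J x, size g = r' & w = wedge (x :: g)]]
  else extp 0.

(* The quotient of the exterior algebra by the boundaries of degree r; the
   homology H_r is the image in it of the cycles of degree r. *)
Definition bdry (r : nat) : set (ext A) := [set ce_d w | w in extp r.+1].
Definition hcl (r : nat) (z : ext A) : quotm (bdry r) := qpi (bdry r) z.

Lemma br_linearl y : linear (br^~ y).
Proof.
move=> a x z; rewrite /br mulrDl mulrDr -scalerAl -scalerAr scalerBr.
by rewrite opprD !addrA; congr (_ - _); rewrite addrAC.
Qed.

Lemma brxx x : br x x = 0. Proof. exact: subrr. Qed.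

Lemma brC x y : br x y = - br y x. Proof. by rewrite /br opprB. Qed.

Lemma br_linear x : linear (br x).
Proof. by move=> a y z; rewrite brC br_linearl opprD -scalerN -!brC. Qed.

Lemma del_cat1 i s t : (i < size s)%N -> del i (s ++ t) = del i s ++ t.
Proof.
move=> lt_is; rewrite /del take_cat lt_is drop_cat.
case: ltnP => [|le_si]; first by rewrite catA.
have E : i.+1 = size s by apply/eqP; rewrite eqn_leq lt_is.
by rewrite E subnn drop0 drop_size cats0.
Qed.

Lemma del_cat2 i s t : del (size s + i) (s ++ t) = s ++ del i t.
Proof.
by rewrite /del -addnS take_cat ltnNge leq_addr /= addKn drop_cat ltnNge
  leq_addr /= addKn catA.
Qed.

Lemma size_del i s : (i < size s)%N -> size (del i s) = (size s).-1.
Proof. by move=> h; rewrite size_cat size_take size_drop h; lia. Qed.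

Lemma nth_del i j s : (i < j)%N -> (del j s)`_i = s`_i.
Proof.
move=> ij; rewrite nth_cat size_take.
case: (ltnP j (size s)) => [_|js]; first by rewrite ij nth_take.
case: ltnP => h; first by rewrite nth_take.
by rewrite !nth_default // size_drop; lia.
Qed.

Section Words.
Variables (W : lmodType k) (Phi : A -> seq A -> W).
Hypothesis Phi_linear : forall s, linear (Phi^~ s).
Hypothesis Phi_word : forall x, word_linear (Phi x).
Hypothesis Phi_alt : forall x, word_alternating (Phi x).

Lemma term_linear (G : A -> A) i : linear G ->
  word_linear (fun s => Phi (G s`_i) (del i s)).
Proof.
move=> Gl s t a x y.
have [lt_is|] := ltnP i (size s).
  by rewrite !nth_cat lt_is !del_cat1 ?Phi_word.
move=> /subnKC <-; case: (i - _)%N => [|m].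
  by rewrite !nth_cat addn0 ltnn subnn /= Gl -[size s]addn0 !del_cat2 Phi_linear.
rewrite !nth_cat ltnNge leq_addr addKn /= !del_cat2.
by rewrite /del /= Phi_word.
Qed.

Lemma term_alt (G : A -> A) s t x n (Q : pred nat) :
  ((size s).+1 < n)%N -> Q (size s) = Q (size s).+1 ->
  \sum_(i < n | Q i) (-1) ^+ i *:
     Phi (G (s ++ x :: x :: t)`_i) (del i (s ++ x :: x :: t)) = 0.
Proof.
move=> ltn EQ; set w := s ++ _; set p := size s.
have ltp : (p < n)%N by exact: ltnW.
have wp : w`_p = x by rewrite nth_cat ltnn subnn.
have wp1 : w`_p.+1 = x by rewrite nth_cat ltnNge leqnSn subSnn.
have dp : del p w = s ++ x :: t by rewrite -[p]addn0 del_cat2.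
have dp1 : del p.+1 w = s ++ x :: t by rewrite -addn1 del_cat2 /del /= drop0.
have other i : (i != p) -> (i != p.+1) -> forall y, Phi y (del i w) = 0.
  move=> ip ip1 y; have [lt_ip|] := ltnP i p.
    by rewrite del_cat1 ?Phi_alt.
  move=> /subnKC E; move: ip ip1; rewrite -E.
  case: (i - p)%N => [|[|m]] ip ip1; [lia|lia|].
  by rewrite del_cat2 /del /= Phi_alt.
rewrite big_mkcond (bigD1 (Ordinal ltp)) //= (bigD1 (Ordinal ltn)) /=; last first.
  by rewrite -val_eqE /= eqn_leq ltnn.
rewrite big1 => [|i /andP[]]; last first.
  rewrite -!val_eqE /= => ip ip1; case: ifP => // _.
  by rewrite other ?scaler0.
rewrite addr0 wp wp1 dp dp1 EQ; case: ifP => _; last by rewrite addr0.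
by rewrite exprS mulN1r scaleNr subrr.
Qed.

Definition sum1 x s : W :=
  \sum_(i < size s) (-1) ^+ i *: Phi (br x s`_i) (del i s).

Definition sum2 s : W :=
  \sum_(j < size s) \sum_(i < size s | (i < j)%N)
     (-1) ^+ (i + j) *: Phi (br s`_i s`_j) (del i (del j s)).

Lemma sum1_linear x : word_linear (sum1 x).
Proof.
move=> s t a y z; rewrite /sum1 !size_cat /= scaler_sumr -big_split /=.
apply: eq_bigr => i _; rewrite (term_linear _ (br_linear x)).
by rewrite scalerDr !scalerA mulrC.
Qed.

Lemma sum1_alt x : word_alternating (sum1 x).
Proof.
move=> s t y; rewrite /sum1 (@term_alt (br x) s t y _ predT) //.
by rewrite size_cat /=; lia.
Qed.

Lemma sum2E s : sum2 s = \sum_(j < size s) (-1) ^+ j *: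
  \sum_(i < size s | (i < j)%N)
    (-1) ^+ i *: Phi (br (del j s)`_i s`_j) (del i (del j s)).
Proof.
apply: eq_bigr => j _; rewrite scaler_sumr; apply: eq_bigr => i ij.
by rewrite scalerA -exprD addnC nth_del.
Qed.

Lemma sum2_linear : word_linear sum2.
Proof.
move=> s t a x y; rewrite !sum2E !size_cat /= scaler_sumr -big_split /=.
apply: eq_bigr => -[j /= jn] _.
rewrite scalerA [a * _]mulrC -scalerA -scalerDr; congr (_ *: _).
rewrite scaler_sumr -big_split /=; apply: eq_bigr => -[i /= i_n] ij.
rewrite scalerA [a * _]mulrC -scalerA -scalerDr; congr (_ *: _).
have [lt_js|] := ltnP j (size s).
  rewrite !(del_cat1 _ lt_js) !(nth_cat 0 s _ j) lt_js.
  exact: (term_linear i (br_linearl s`_j)).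
move=> /subnKC E; move: jn ij; rewrite -E; case: (j - _)%N => [|m] jn ij.
  rewrite !del_cat2 !(nth_cat 0 s _ (size s + _)) addn0 ltnn subnn /= /del /=.
  by rewrite br_linear Phi_linear.
rewrite !del_cat2 !(nth_cat 0 s _ (size s + _)) ltnNge leq_addr addKn /=.
exact: (term_linear i (br_linearl t`_m)).
Qed.

Lemma sum2_alt : word_alternating sum2.
Proof.
move=> s t x; rewrite sum2E; set w := s ++ _; set p := size s; set n := size w.
have ltp1 : (p.+1 < n)%N by rewrite /n /w /p size_cat /=; lia.
have ltp : (p < n)%N by exact: ltnW.
have wp : w`_p = x by rewrite nth_cat ltnn subnn.
have wp1 : w`_p.+1 = x by rewrite nth_cat ltnNge leqnSn subSnn.
have dp : del p w = s ++ x :: t by rewrite -[p]addn0 del_cat2.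
have dp1 : del p.+1 w = s ++ x :: t by rewrite -addn1 del_cat2 /del /= drop0.
rewrite (bigD1 (Ordinal ltp)) //= [X in _ + X](bigD1 (Ordinal ltp1)) /=; last first.
  by rewrite -val_eqE /= eqn_leq ltnn.
rewrite [X in _ + (_ + X)]big1 => [|[j /= jn] /andP[]]; last first.
  rewrite -!val_eqE /= => jp jp1; have [lt_jp|] := ltnP j p.
    have sj : size (del j s) = p.-1 by rewrite size_del.
    rewrite del_cat1 // (@term_alt (br^~ w`_j) _ _ _ _ (fun i => i < j)%N) ?scaler0 //.
      by rewrite sj; lia.
    by rewrite sj; lia.
  move=> /subnKC E; move: jn jp jp1; rewrite -E.
  case: (j - p)%N => [|[|m]] jn jp jp1; [lia|lia|].
  rewrite del_cat2 /del /= -/(del m t).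
  rewrite (@term_alt (br^~ w`_(p + m.+2)) _ _ _ _ (fun i => i < p + m.+2)%N) ?scaler0 //.
  by rewrite -/p; lia.
rewrite addr0 wp wp1 dp dp1 exprS mulN1r scaleNr.
apply/eqP; rewrite subr_eq0; apply/eqP; congr (_ *: _).
rewrite [RHS](bigD1 (Ordinal ltp)) //=.
have -> : (s ++ x :: t)`_p = x by rewrite nth_cat ltnn subnn.
have Phi0 u : Phi 0 u = 0.
  have := Phi_linear u (-1) 0 0.
  by rewrite scaler0 addr0 scaleN1r addNr.
rewrite brxx Phi0 scaler0 add0r; apply: eq_bigl => i.
by rewrite -val_eqE /=; lia.
Qed.

End Words.

Lemma ce_wordE : ce_word = sum2 (fun x s => wedge (x :: s)).
Proof. by []. Qed.

Fact wedge_cons_linear s : linear (fun x : A => wedge (x :: s)).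
Proof. by move=> a x y; exact: (@wedge_linear _ _ [::]). Qed.
Fact wedge_cons_word x : word_linear (fun s => wedge (x :: s)).
Proof. by move=> s t a y z; exact: (@wedge_linear _ _ (x :: s)). Qed.
Fact wedge_cons_alt x : word_alternating (fun s => wedge (x :: s)).
Proof. by move=> s t y; exact: (@wedge_alternating _ _ (x :: s)). Qed.

Fact ce_word_rel r : @ext_rel k A r -> fglift ce_word r = 0.
Proof.
apply: ext_rel_lift; rewrite ce_wordE.
  exact: sum2_linear wedge_cons_linear wedge_cons_word.
exact: sum2_alt wedge_cons_linear wedge_cons_alt.
Qed.

Lemma ce_d_linear : linear ce_d.
Proof. exact: plift_linear ce_word_rel. Qed.

Lemma ce_d_wedge s : ce_d (wedge s) = ce_word s.
Proof. exact: plift_gen ce_word_rel _. Qed.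

Lemma adj_wordE x s : adj_word x s =
  - sum1 (fun y t => tens y (wedge t)) x s - tens x (ce_word s).
Proof.
rewrite /adj_word /sum1 /ce_word (linear_sum (tens x)) -!sumrN; congr (_ + _).
  by apply: eq_bigr => i _; rewrite exprS mulN1r scaleNr.
apply: eq_bigr => j _; rewrite (linear_sum (tens x)) -sumrN; apply: eq_bigr => i _.
by rewrite linearZ /= addn1 !addSn addnS !exprS !mulN1r opprK scaleNr.
Qed.

Fact tens_wedge_word x : word_linear (fun s : seq A => tens x (wedge s)).
Proof. by move=> s t a y z; rewrite wedge_linear linearP. Qed.
Fact tens_wedge_alt x : word_alternating (fun s : seq A => tens x (wedge s)).
Proof. by move=> s t y; rewrite wedge_alternating linear0. Qed.

Fact adj_word_rel x r : @ext_rel k A r -> fglift (adj_word x) r = 0.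
Proof.
apply: ext_rel_lift => [s t a y z|s t y]; rewrite !adj_wordE.
  rewrite (sum1_linear (fun s => tens_linearl (wedge s)) tens_wedge_word).
  rewrite ce_wordE (sum2_linear wedge_cons_linear wedge_cons_word).
  rewrite (linearP (tens x)).
  by rewrite scalerBr scalerN !opprD !addrA; congr (_ - _); rewrite addrAC.
rewrite (sum1_alt tens_wedge_alt) ce_wordE.
by rewrite (sum2_alt wedge_cons_linear wedge_cons_alt) (linear0 (tens x)) !oppr0 addr0.
Qed.

Fact adj_d_rel r : @tens_rel k A (ext A) r ->
  fglift (fun p : A * ext A => plift (adj_word p.1) p.2) r = 0.
Proof.
apply: tens_rel_lift => [w|x] /=; last exact: plift_linear (@adj_word_rel x).
move=> a x y; rewrite /plift !fgliftE scaler_sumr -big_split /=.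
apply: eq_bigr => s _; rewrite scalerA [a * _]mulrC -scalerA -scalerDr.
congr (_ *: _); rewrite !adj_wordE tens_linearl !scalerBr !scalerN.
set u := sum1 _ _ _; set v := sum1 _ _ _; set z := sum1 _ _ _.
have -> : u = a *: v + z.
  rewrite /u /v /z /sum1 scaler_sumr -big_split /=; apply: eq_bigr => i _.
  rewrite (br_linearl (s`_i)) tens_linearl scalerDr !scalerA.
  by rewrite [a * _]mulrC.
by rewrite !opprD addrACA.
Qed.

Lemma adj_d_linear : linear adj_d.
Proof. exact: plift_linear adj_d_rel. Qed.

Lemma adj_d_tens x s : adj_d (tens x (wedge s)) = adj_word x s.
Proof. by rewrite /adj_d /tens (plift_gen adj_d_rel) (plift_gen (@adj_word_rel x)). Qed.

End ChevalleyEilenberg.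

Section TateClass.
Variables (k : fieldType) (n : nat).
Local Notation G := (Epow k n).

(* The sign (-1)^b; accordingly (-1)^(s_1 + ... + s_n) is the product of the
   signs s_i. *)
Definition sg (b : bool) : k := if b then 1 else -1.

(* An element of {+, -, 0}^n: [Some true] is +, [Some false] is -, [None] is 0. *)
Definition signs := {ffun 'I_n -> option bool}.

Definition sdeg (s : signs) : nat := (1 + #|[pred i | s i == None]|)%N.

Definition setz (s : signs) (i : 'I_n) : signs :=
  [ffun j => if j == i then None else s j].

Definition Xpart (i : 'I_n) (e : option bool) (r : nat) : set (ext G) :=
  if e is Some b then ce (@Iat k n i b) r
  else ce (@Iat k n i true) r `&` ce (@Iat k n i false) r.

(* For p >= 1, the elements of degree r of T^p, as families indexed by all of
   {+, -, 0}^n that vanish at the s of degree other than p; T^0_r is extp r. *)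
Definition Tcx (p r : nat) : set {ffun signs -> ext G} :=
  [set f : {ffun signs -> ext G} | forall s,
     if sdeg s == p then forall i : 'I_n, Xpart i (s i) r (f s) else f s = 0].

Definition bd (f : {ffun signs -> ext G}) : {ffun signs -> ext G} :=
  [ffun s : signs => \sum_(i | s i != None)
     (-1) ^+ #|[pred j : 'I_n | (i < j)%N && (s j == None)]| *: f (setz s i)].

Definition bd1 (f : {ffun signs -> ext G}) : ext G :=
  \sum_(g : {ffun 'I_n -> bool})
     (\prod_i sg (g i)) *: f [ffun i => Some (g i)].

Definition zigzag (z : ext G) (th : nat -> {ffun signs -> ext G}) : Prop :=
  [/\ forall i, (1 <= i <= n.+1)%N -> Tcx i (n.+2 - i) (th i),
      bd1 (th 1%N) = z
    & forall i, (1 <= i <= n)%N -> bd (th i.+1) = [ffun s => ce_d (th i s)]].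

(* The value c of res_* at the homology class h in H_{n+1}; T^{n+1}_1 is the
   (0, ..., 0)-component I_tr, identified with the words of length 1. *)
Definition res_rel (h : quotm (@bdry k G n.+1)) (c : k) : Prop :=
  exists z th x,
    [/\ extp n.+1 z /\ ce_d z = 0, hcl n.+1 z = h, zigzag z th,
        th n.+1 [ffun=> None] = wedge [:: x] & Itr k n x /\ tau x = c].

Definition res_star (h : quotm (@bdry k G n.+1)) : k :=
  xget 0 [set c | res_rel h c].

(* The Tate class as a functional on cycles of degree n+1. *)
Definition tate_class (z : ext G) : k := res_star (hcl n.+1 z).

Definition idem (P : 'I_n -> G) (b : bool) (i : 'I_n) : G :=
  if b then P i else 1 - P i.

Definition good_idempotents (P : 'I_n -> G) : Prop :=
  [/\ forall i j, P i * P j = P j * P i,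
      forall i, P i * P i = P i
    & forall b (i : 'I_n) (a : G), Iat i b (idem P b i * a)].

End TateClass.

(* Main.v *)
Require Import Defs.
From HB Require Import structures.
From mathcomp Require Import all_boot all_order all_algebra all_fingroup.
From mathcomp Require Import zify.
From mathcomp.multinomials Require Import freeg.
From mathcomp Require Import boolp classical_sets functions fsbigop.

Set Implicit Arguments.
Unset Strict Implicit.
Unset Printing Implicit Defensive.

Import Order.TTheory GRing.Theory Num.Theory.
Local Open Scope ring_scope.

(** The residue of a cycle is read off from a zigzag through the cubical
    complex T, so there are two things to prove: the value does not depend on
    the zigzag, and one explicit zigzag ends in the argument of the trace.

    Both use the same contraction. Suppose that there are operators [p_i^+] and
    [p_i^-] with sum the identity, such that [p_i^s] has values in [X_i^s] and
    all of them preserve every [X_j^t]. Then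
      (f_+, f_-) |-> p_i^- f_+ + p_i^+ f_-
    contracts X_i^0 -> X_i^+ (+) X_i^- onto its augmentation f_+ - f_-, which has
    the section w |-> (p_i^+ w, - p_i^- w). The complex T is the product of
    these n resolutions, and [htpys] is the telescoping product of their
    contractions ([htpys_homotopy]); hence T is exact ([cube_exact]), with
    explicit preimages.

    _Independence of the zigzag._ On the exterior algebra, [p_i^-] is the
    endomorphism induced by left multiplication by [P_i^-], and [p_i^+] is its
    complement ([eproj]). Chasing with the contraction, a zigzag that starts at a
    boundary ends in [ce_d eta], where [eta] is a two-vector that lies in
    [I_i^s ^ G] for all [i] and [s] ([zigzag_boundary]). Local units of the ideals
    turn [eta] into a sum of [a ^ b] such that, for each [i] and [s], [a] or [b]
    lies in [I_i^s] ([ce2_simultaneous]). For such pairs all the sums in the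
    traces of [a b] and [b a] are finite, so that [a, b] has trace zero
    ([tau_br]). This gives [res_rel_unique].

    _The explicit zigzag._ The cycle lifts to the complex with adjoint
    coefficients, where the idempotents can act on the coefficient alone
    ([tproj]); this lift is a cycle by hypothesis, and the multiplication
    [x (x) w |-> x ^ w] carries zigzags there to zigzags of T ([mu_adj_d],
    [tzigzag_zigzag]). In the component with zeros exactly at the last places, a
    single summand of [htpys] contributes, and the signs at the other places sum
    away because P_i^+ + P_i^- = 1. So the m-th place contributes the operator
      P_m^- delta P_m^+ - P_m^+ delta P_m^-
    ([tzigzag_path]). The summands of delta that do not touch the coefficient
    commute with the idempotents and disappear, as P_m^- P_m^+ = 0
    ([tcontr_tens]); what remains brackets the coefficient with one letter and
    removes that letter. Composing these operators gives the sum over all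
    permutations of the letters ([tcontrs_tens], [altsum_contr]), with total sign
    (-1)^(n (n - 1)) = 1.

    Both halves need that the differentials square to zero, which is derived
    from Cartan's formula ([adj_d2], [ce_d2]). *)

(** * Linear maps and presentations *)

(** Decides an identity between signed sums in an abelian group: everything is
    moved to the left, and each last term is cancelled against its opposite. *)
Ltac zmod_cancel :=
  apply/eqP; rewrite -subr_eq0;
  match goal with |- is_true (?s == _) => rewrite -(add0r s) end;
  rewrite ?(opprD, opprK, addrA);
  repeat match goal with
  | |- is_true (_ - ?a == 0) => rewrite ?(addrAC _ a _) addrNK
  | |- is_true (_ + ?a == 0) => rewrite ?(addrAC _ (- a) _) addrK
  end; by rewrite ?eqxx.

Section LinearMaps.
Variables (k : fieldType) (U V W : lmodType k).
Implicit Types f g : U -> V.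

Section Rules.
Variables (f : U -> V) (fl : linear f).

Lemma lin0 : f 0 = 0.
Proof. by have := fl (-1) 0 0; rewrite scaler0 addr0 scaleN1r addNr. Qed.

Lemma linZ a x : f (a *: x) = a *: f x.
Proof. by have := fl a x 0; rewrite lin0 !addr0. Qed.

Lemma linD x y : f (x + y) = f x + f y.
Proof. by have := fl 1 x y; rewrite !scale1r. Qed.

Lemma linN x : f (- x) = - f x.
Proof. by rewrite -scaleN1r linZ scaleN1r. Qed.

Lemma linB x y : f (x - y) = f x - f y.
Proof. by rewrite linD linN. Qed.

Lemma lin_sum (I : Type) (r : seq I) (P : pred I) (F : I -> U) :
  f (\sum_(i <- r | P i) F i) = \sum_(i <- r | P i) f (F i).
Proof. exact: (big_morph f linD lin0). Qed.

End Rules.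

Lemma linear_comp (h : V -> W) f : linear h -> linear f -> linear (fun x => h (f x)).
Proof. by move=> hl fl a x y; rewrite fl hl. Qed.

Lemma linear_add f g : linear f -> linear g -> linear (fun x => f x + g x).
Proof. by move=> fl gl a x y; rewrite fl gl scalerDr addrACA. Qed.

Lemma linear_opp f : linear f -> linear (fun x => - f x).
Proof. by move=> fl a x y; rewrite fl opprD scalerN. Qed.

Lemma linear_sub f g : linear f -> linear g -> linear (fun x => f x - g x).
Proof. by move=> fl gl; apply: linear_add => //; apply: linear_opp. Qed.

Lemma linear_scale b f : linear f -> linear (fun x => b *: f x).
Proof. by move=> fl a x y; rewrite fl scalerDr !scalerA mulrC. Qed.

Lemma linear_id : linear (fun x : U => x).
Proof. by []. Qed.

Lemma linear_zero : linear (fun _ : U => 0 : V).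
Proof. by move=> a x y; rewrite scaler0 addr0. Qed.

End LinearMaps.

Section Extensionality.
Variable k : fieldType.

Lemma pres_eq (T : choiceType) (rel : set {freeg T / k}) (W : lmodType k)
    (F G : pres rel -> W) :
  linear F -> linear G -> (forall t, F (pgen rel t) = G (pgen rel t)) -> F =1 G.
Proof.
move=> Fl Gl FG x; rewrite -[x]qreprK -(freeg_sumE (qrepr x)) linear_sum.
rewrite (lin_sum Fl) (lin_sum Gl); apply: eq_bigr => t _.
have -> : << coeff t (qrepr x) *g t >> = coeff t (qrepr x) *: << t >>.
  apply/eqP/freeg_eqP => u; rewrite -[_ *: _]/(fgscale _ _).
  by rewrite coeff_fgscale !coeffU mul1r.
by rewrite linearZ (linZ Fl) (linZ Gl); congr (_ *: _); apply: FG.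
Qed.

Lemma ext_eq (V W : lmodType k) (F G : ext V -> W) :
  linear F -> linear G -> (forall s, F (wedge s) = G (wedge s)) -> F =1 G.
Proof. exact: pres_eq. Qed.

Lemma tensor_eq (V U W : lmodType k) (F G : tensor V U -> W) :
  linear F -> linear G -> (forall x u, F (tens x u) = G (tens x u)) -> F =1 G.
Proof. by move=> Fl Gl FG; apply: pres_eq => // -[x u]; apply: FG. Qed.

Lemma tensBl (V U : lmodType k) (x y : V) (u : U) :
  tens (x - y) u = tens x u - tens y u.
Proof. exact: (linB (tens_linearl u)). Qed.

End Extensionality.

(** * The differentials square to zero *)

Section Differentials.
Variables (k : fieldType) (A : algType k).
Implicit Types (x y z : A) (s : seq A) (w : ext A) (u : tensor A (ext A)).

Lemma tensor_ext_eq (W : lmodType k) (F G : tensor A (ext A) -> W) :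
  linear F -> linear G ->
  (forall x s, F (tens x (wedge s)) = G (tens x (wedge s))) -> F =1 G.
Proof.
move=> Fl Gl FG; apply: tensor_eq => // x.
apply: ext_eq => [||s]; last exact: FG.
- exact: linear_comp Fl (tens_linear x).
- exact: linear_comp Gl (tens_linear x).
Qed.

Definition wcons x : ext A -> ext A := plift (fun s => wedge (x :: s)).

Fact wcons_rel x r : @ext_rel k A r -> fglift (fun s => wedge (x :: s)) r = 0.
Proof. by apply: ext_rel_lift; [exact: wedge_cons_word|exact: wedge_cons_alt]. Qed.

Lemma wconsL x : linear (wcons x).
Proof. exact: plift_linear (@wcons_rel x). Qed.

Lemma wcons_wedge x s : wcons x (wedge s) = wedge (x :: s).
Proof. exact: plift_gen (@wcons_rel x) _. Qed.

Lemma wcons_linearl w : linear (wcons^~ w).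
Proof.
move=> a x y; move: w; apply: ext_eq => [||s].
- exact: wconsL.
- by apply: linear_add; [apply: linear_scale|]; apply: wconsL.
- by rewrite !wcons_wedge wedge_cons_linear.
Qed.

Lemma wconsxx x w : wcons x (wcons x w) = 0.
Proof.
move: w; apply: ext_eq => [||s].
- exact: (linear_comp (wconsL x) (wconsL x)).
- exact: linear_zero.
by rewrite !wcons_wedge (@wedge_alternating _ _ [::]).
Qed.

Lemma wconsC x y w : wcons x (wcons y w) = - wcons y (wcons x w).
Proof.
apply/eqP; rewrite -addr_eq0; have := wconsxx (x + y) w.
rewrite !(linD (wcons_linearl _)) !(linD (wconsL _)) !wconsxx.
by rewrite add0r addr0 => /eqP.
Qed.

(** The multiplication [x (x) w |-> x ^ w]. It intertwines the differentials,
    which is how statements about [adj_d] give statements about [ce_d]. *)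
Definition mu : tensor A (ext A) -> ext A := plift (fun p => wcons p.1 p.2).

Fact mu_rel r : @tens_rel k A (ext A) r -> fglift (fun p => wcons p.1 p.2) r = 0.
Proof.
apply: tens_rel_lift => [w|x] /=; first exact: wcons_linearl.
exact: wconsL.
Qed.

Lemma muL : linear mu. Proof. exact: plift_linear mu_rel. Qed.

Lemma mu_tens x w : mu (tens x w) = wcons x w.
Proof. exact: (plift_gen mu_rel). Qed.

Definition tcons y : tensor A (ext A) -> tensor A (ext A) :=
  plift (fun p => tens p.1 (wcons y p.2)).

Fact tcons_rel y r : @tens_rel k A (ext A) r ->
  fglift (fun p : A * ext A => tens p.1 (wcons y p.2)) r = 0.
Proof.
apply: tens_rel_lift => [w|x] /=; first exact: tens_linearl.
exact: linear_comp (tens_linear x) (wconsL y).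
Qed.

Lemma tconsL y : linear (tcons y).
Proof. exact: plift_linear (@tcons_rel y). Qed.

Lemma tcons_tens y x w : tcons y (tens x w) = tens x (wcons y w).
Proof. exact: (plift_gen (@tcons_rel y)). Qed.

Lemma mu_tcons y u : mu (tcons y u) = - wcons y (mu u).
Proof.
move: u; apply: tensor_eq => [||x w].
- exact: linear_comp muL (tconsL y).
- exact: linear_opp (linear_comp (wconsL y) muL).
- by rewrite tcons_tens !mu_tens wconsC.
Qed.

(** The part of [adj_d] that brackets [x] with the letters of [w], up to sign.
    Taking it as what [adj_d] leaves over makes it well defined on the
    exterior algebra without checking relations; [adbr_wedge] is the formula. *)
Definition adbr x w : tensor A (ext A) := - adj_d (tens x w) - tens x (ce_d w).

Lemma adbrL x : linear (adbr x).
Proof.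
apply: linear_sub.
  exact: linear_opp (linear_comp (@adj_d_linear _ _) (tens_linear x)).
exact: linear_comp (tens_linear x) (@ce_d_linear _ _).
Qed.

Lemma adj_dE x w : adj_d (tens x w) = - adbr x w - tens x (ce_d w).
Proof. by rewrite /adbr opprB addrAC addrN add0r opprK. Qed.

Lemma adbr_wedge x s : adbr x (wedge s) =
  \sum_(i < size s) (-1) ^+ i *: tens (br x s`_i) (wedge (del i s)).
Proof.
by rewrite /adbr adj_d_tens adj_wordE ce_d_wedge opprB opprK addrAC subrr add0r.
Qed.

Lemma adbr_nil x : adbr x (wedge [::]) = 0.
Proof. by rewrite adbr_wedge big_ord0. Qed.

Lemma adbr_cons x y w : adbr x (wcons y w) = tens (br x y) w - tcons y (adbr x w).
Proof.
move: w; apply: ext_eq => [||s].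
- exact: linear_comp (adbrL x) (wconsL y).
- exact: linear_sub (tens_linear _) (linear_comp (tconsL y) (adbrL x)).
rewrite wcons_wedge !adbr_wedge big_ord_recl /= scale1r /del /= drop0.
congr (_ + _); rewrite (lin_sum (tconsL y)) -sumrN; apply: eq_bigr => i _.
by rewrite (linZ (tconsL y)) tcons_tens wcons_wedge exprS mulN1r scaleNr.
Qed.

Lemma ce_word_cons x s : ce_word (x :: s) =
  - (\sum_(j < size s) (-1) ^+ j *: wedge (br x s`_j :: del j s))
  - wcons x (ce_word s).
Proof.
rewrite /ce_word /= big_ord_recl big_pred0_eq add0r (lin_sum (wconsL x)).
rewrite -!sumrN -big_split /=; apply: eq_bigr => j _.
rewrite big_mkcond big_ord_recl /= add0n exprS mulN1r scaleNr [del 0 _]drop0.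
congr (_ + _); rewrite (lin_sum (wconsL x)) -sumrN [RHS]big_mkcond.
apply: eq_bigr => i _; rewrite /= ltnS /bump /= !add1n.
case: ifP => // ij.
rewrite (linZ (wconsL x)) wcons_wedge -!wcons_wedge wconsC scalerN addSn addnS.
by rewrite !exprS !mulN1r opprK.
Qed.

Lemma mu_adbr x w : mu (adbr x w) = - ce_d (wcons x w) - wcons x (ce_d w).
Proof.
move: w; apply: ext_eq => [||s].
- exact: linear_comp muL (adbrL x).
- apply: linear_sub.
    exact: linear_opp (linear_comp (@ce_d_linear _ _) (wconsL x)).
  exact: linear_comp (wconsL x) (@ce_d_linear _ _).
rewrite adbr_wedge ce_d_wedge wcons_wedge ce_d_wedge ce_word_cons opprB opprK.
rewrite addrAC subrr add0r (lin_sum muL); apply: eq_bigr => j _.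
by rewrite (linZ muL) mu_tens wcons_wedge.
Qed.

Lemma mu_adj_d u : mu (adj_d u) = ce_d (mu u).
Proof.
move: u; apply: tensor_eq => [||x w].
- exact: linear_comp muL (@adj_d_linear _ _).
- exact: linear_comp (@ce_d_linear _ _) muL.
rewrite adj_dE (linB muL) (linN muL) mu_adbr !mu_tens opprD !opprK.
by rewrite addrK.
Qed.

(** The Lie derivatives along [y] on the two complexes. For [lie], Cartan's
    formula is [ce_d_wcons]; for [tlie], it is the definition. *)
Definition lie y w : ext A := mu (adbr y w).
Definition tlie y u : tensor A (ext A) := adj_d (tcons y u) + tcons y (adj_d u).

Lemma lieL y : linear (lie y). Proof. exact: linear_comp muL (adbrL y). Qed.

Lemma tlieL y : linear (tlie y).
Proof.
apply: linear_add; first exact: linear_comp (@adj_d_linear _ _) (tconsL y).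
exact: linear_comp (tconsL y) (@adj_d_linear _ _).
Qed.

Lemma ce_d_wcons y w : ce_d (wcons y w) = - lie y w - wcons y (ce_d w).
Proof. by rewrite /lie mu_adbr opprB opprK addrAC subrr add0r. Qed.

Lemma adj_d_tcons y u : adj_d (tcons y u) = tlie y u - tcons y (adj_d u).
Proof. by rewrite addrK. Qed.

Lemma lie_nil y : lie y (wedge [::]) = 0.
Proof. by rewrite /lie adbr_nil (lin0 muL). Qed.

Lemma lie_wcons y z w : lie y (wcons z w) = wcons (br y z) w + wcons z (lie y w).
Proof. by rewrite /lie adbr_cons (linB muL) mu_tens mu_tcons opprK. Qed.

Lemma tlie_tens y z w : tlie y (tens z w) = tens (br y z) w + tens z (lie y w).
Proof.
rewrite /tlie tcons_tens !adj_dE adbr_cons ce_d_wcons [br z y]brC.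
move: (adbr z w) (lie y w) (ce_d w) => u v v'.
rewrite (linN (tens_linearl w)) (linB (tens_linear z)) (linN (tens_linear z)).
rewrite (linB (tconsL y)) (linN (tconsL y)) tcons_tens !opprD !opprK.
have E (V : zmodType) (a b c d : V) : a + b + (c + d) + (- b - d) = a + c.
  by zmod_cancel.
exact: E.
Qed.

Lemma tlie_tcons y z u :
  tlie y (tcons z u) = tcons (br y z) u + tcons z (tlie y u).
Proof.
move: u; apply: tensor_eq => [||x w].
- exact: linear_comp (tlieL y) (tconsL z).
- exact: linear_add (tconsL _) (linear_comp (tconsL z) (tlieL y)).
rewrite tcons_tens !tlie_tens lie_wcons (linD (tens_linear x)).
by rewrite (linD (tconsL z)) !tcons_tens addrCA.
Qed.

Lemma br_jacobi x y z : br y (br x z) - br x (br y z) = br (br y x) z.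
Proof.
rewrite /br !mulrBr !mulrBl !mulrA.
move: (y * x * z) (y * z * x) (x * z * y) (z * x * y) => *.
zmod_cancel.
Qed.

(** Equivariance of [adbr] under the Lie derivatives; on a word, every letter
    contributes one instance of the Jacobi identity. *)
Lemma tlie_adbr y x w : tlie y (adbr x w) = adbr x (lie y w) + adbr (br y x) w.
Proof.
move: w; apply: ext_eq => [||s].
- exact: linear_comp (tlieL y) (adbrL x).
- exact: linear_add (linear_comp (adbrL x) (lieL y)) (adbrL _).
elim: s => [|z s IH].
  by rewrite lie_nil !adbr_nil (lin0 (tlieL y)) (lin0 (adbrL x)) addr0.
rewrite -wcons_wedge lie_wcons (linD (adbrL x)) !adbr_cons (linB (tlieL y)).
rewrite tlie_tens tlie_tcons IH (linD (tconsL z)) -br_jacobi.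
rewrite (tensBl (br y (br x z))).
have E (V : zmodType) (a b c d e f : V) :
    a + b - (c + (d + e)) = f - c + (b - d) + (a - f - e).
  by zmod_cancel.
exact: E.
Qed.

(** By induction on the word: for a new first letter [y], the differential of
    [tens (br x y) w] produces brackets with [br x y], which cancel against the
    ones that moving [tlie y] past [adbr x] produces. *)
Lemma adj_d_adbr x w : adj_d (adbr x w) = adbr x (ce_d w).
Proof.
move: w; apply: ext_eq => [||s].
- exact: linear_comp (@adj_d_linear _ _) (adbrL x).
- exact: linear_comp (adbrL x) (@ce_d_linear _ _).
elim: s => [|y s IH].
  by rewrite adbr_nil ce_d_wedge /ce_word big_ord0 (lin0 (@adj_d_linear _ _))
    (lin0 (adbrL x)).
rewrite -wcons_wedge adbr_cons (linB (@adj_d_linear _ _)) adj_d_tcons tlie_adbr.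
rewrite adj_dE IH ce_d_wcons (linB (adbrL x)) (linN (adbrL x)) adbr_cons.
rewrite [br x y]brC.
have -> : adbr (- br y x) (wedge s) = - adbr (br y x) (wedge s).
  rewrite /adbr !(linN (tens_linearl _)) (linN (@adj_d_linear _ _)).
  by rewrite -opprD.
have E (V : zmodType) (a b c d : V) : - - a - b - (c + a - d) = - c - (b - d).
  by zmod_cancel.
exact: E.
Qed.

(** By [adj_d_adbr], the square of [adj_d] on [x (x) w] is [x (x) ce_d (ce_d w)],
    and [ce_d (ce_d w)] is the image under [mu] of the square of [adj_d] on a
    shorter word; so the two complexes are treated in one induction. *)
Lemma adj_d2 u : adj_d (adj_d u) = 0.
Proof.
move: u; apply: tensor_ext_eq => [||x s].
- exact: linear_comp (@adj_d_linear _ _) (@adj_d_linear _ _).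
- exact: linear_zero.
elim: s x => [|y s IH] x.
  by rewrite !adj_dE adbr_nil ce_d_wedge /ce_word big_ord0 (lin0 (tens_linear x))
    subr0 oppr0 (lin0 (@adj_d_linear _ _)).
have dd : ce_d (ce_d (wedge (y :: s))) = 0.
  by rewrite -wcons_wedge -mu_tens -!mu_adj_d IH (lin0 muL).
rewrite adj_dE (linB (@adj_d_linear _ _)) (linN (@adj_d_linear _ _)) adj_d_adbr.
by rewrite adj_dE dd (lin0 (tens_linear x)) subr0 opprK addNr.
Qed.

Lemma ce_d2 w : ce_d (ce_d w) = 0.
Proof.
move: w; apply: ext_eq => [||[|y s]].
- exact: linear_comp (@ce_d_linear _ _) (@ce_d_linear _ _).
- exact: linear_zero.
- by rewrite ce_d_wedge /ce_word big_ord0 (lin0 (@ce_d_linear _ _)).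
- by rewrite -wcons_wedge -mu_tens -!mu_adj_d adj_d2 (lin0 muL).
Qed.

End Differentials.

(** * The contraction of the cubical complex *)

Section Signs.
Variable n : nat.
Implicit Types (s : signs n) (i j : 'I_n) (e : option bool).

Definition upd s i e : signs n := [ffun j => if j == i then e else s j].

Definition zeros_after s i : nat :=
  #|[pred j : 'I_n | (i < j)%N && (s j == None)]|.

Lemma updE s i e j : upd s i e j = if j == i then e else s j.
Proof. by rewrite ffunE. Qed.

Lemma upd_at s i e : upd s i e i = e.
Proof. by rewrite updE eqxx. Qed.

Lemma upd_ne s i e j : j != i -> upd s i e j = s j.
Proof. by rewrite updE => /negPf ->. Qed.

Lemma upd_id s i e : s i = e -> upd s i e = s.
Proof. by move=> E; apply/ffunP => j; rewrite updE; case: eqP => // ->. Qed.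

Lemma upd_upd s i e e' : upd (upd s i e) i e' = upd s i e'.
Proof. by apply/ffunP => j; rewrite !updE; case: eqP. Qed.

Lemma updC s i j e e' : i != j -> upd (upd s i e) j e' = upd (upd s j e') i e.
Proof.
move=> ij; apply/ffunP => l; rewrite !updE.
by case: (eqVneq l j) => // ->; rewrite eq_sym (negPf ij).
Qed.

(** The correction terms stand on both sides so that no truncated subtraction
    occurs; the same holds for [sdeg_upd]. *)
Lemma zeros_after_upd s i j e :
  (zeros_after (upd s i e) j + (j < i) * (s i == None) =
   zeros_after s j + (j < i) * (e == None))%N.
Proof.
have E t : zeros_after t j =
    (\sum_(l : 'I_n) (if (j < l)%N && (t l == None) then 1 else 0))%N.
  by rewrite /zeros_after -sum1_card big_mkcond.
rewrite !E (bigD1 i) //= [in RHS](bigD1 i) //= upd_at.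
rewrite (eq_bigr (fun l : 'I_n => if (j < l)%N && (s l == None) then 1 else 0)%N).
  move: (\sum_(_ < _ | _) _)%N => q.
  by case: (j < i)%N; case: (e == None); case: (s i == None) => /=; lia.
by move=> l li; rewrite upd_ne.
Qed.

Lemma sdeg_upd s i e :
  (sdeg (upd s i e) + (s i == None) = sdeg s + (e == None))%N.
Proof.
have E t : sdeg t = (1 + \sum_(l : 'I_n) (if t l == None then 1 else 0))%N.
  by rewrite /sdeg -sum1_card [in RHS]big_mkcond [in LHS]big_mkcond.
rewrite !E (bigD1 i) //= [in RHS](bigD1 i) //= upd_at.
rewrite (eq_bigr (fun l : 'I_n => if s l == None then 1 else 0)%N).
  move: (\sum_(_ < _ | _) _)%N => q.
  by case: (e == None); case: (s i == None) => /=; lia.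
by move=> l li; rewrite upd_ne.
Qed.

(** The component of index [s] is an intersection over these pairs of a place and
    a sign; a zero of [s] stands for both signs. *)
Definition sides s i b : bool := (s i == None) || (s i == Some b).

End Signs.

(** By induction on the list of places that remain to be expanded. The sum then
    runs over the [g] that are [true] at all other places, so that each choice
    of summands is counted once. *)
Lemma foldr_sum_choices (n : nat) (M : zmodType) (op : 'I_n -> bool -> M -> M) x :
  (forall i b, {morph op i b : y z / y + z}) ->
  foldr (fun i y => op i true y + op i false y) x (enum 'I_n) =
  \sum_(g : {ffun 'I_n -> bool}) foldr (fun i y => op i (g i) y) x (enum 'I_n).
Proof.
move=> opD; have op0 i b : op i b 0 = 0.
  by apply: (@addrI _ (op i b 0)); rewrite -opD !addr0.
pose S (l : seq 'I_n) (g : {ffun 'I_n -> bool}) := [forall i, (i \notin l) ==> g i].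
transitivity (\sum_(g | S (enum 'I_n) g)
    foldr (fun i y => op i (g i) y) x (enum 'I_n)); last first.
  by apply: eq_bigl => g; apply/forallP => i; rewrite mem_enum.
have := enum_uniq 'I_n; elim: (enum 'I_n) => [_|i l IH /= /andP[il ul]] /=.
  rewrite (big_pred1 [ffun=> true]) // => g; apply/forallP/eqP => [h|-> i].
    by apply/ffunP => i; rewrite ffunE; apply: (h i).
  by rewrite ffunE.
pose put b (g : {ffun 'I_n -> bool}) : {ffun 'I_n -> bool} :=
  [ffun j => if j == i then b else g j].
have foldE b g : foldr (fun j y => op j (put b g j) y) x l =
    foldr (fun j y => op j (g j) y) x l.
  elim: l il {IH ul} => //= j l IH; rewrite inE negb_or => /andP[ij jl].
  by rewrite IH // ffunE eq_sym (negPf ij).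
rewrite (bigID (fun g : {ffun _} => g i)) /= IH //.
rewrite !(big_morph _ (opD i _) (op0 i _)); congr (_ + _).
  apply: eq_big => [g|g /forallP h]; last by rewrite (implyP (h i) il).
  apply/forallP/andP => [h|[/forallP h gi] j].
    split; last exact: (implyP (h i) il).
    apply/forallP => j; apply/implyP; rewrite inE negb_or => /andP[_].
    exact: (implyP (h j)).
  apply/implyP => jl; case: (eqVneq j i) => [->//|ji].
  by apply: (implyP (h j)); rewrite inE negb_or ji.
rewrite [RHS](reindex_onto (put false) (put true)) /=; last first.
  move=> g /andP[_ gi]; apply/ffunP => j; rewrite !ffunE.
  by case: eqP => // ->; rewrite (negPf gi).
apply: eq_big => [g|g _]; last by rewrite ffunE eqxx foldE.
rewrite ffunE eqxx andbT; apply/forallP/andP => [h|[/forallP h /eqP <-] j].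
  split.
    apply/forallP => j; apply/implyP; rewrite inE negb_or => /andP[ji jl].
    by rewrite ffunE (negPf ji); apply: (implyP (h j)).
  apply/eqP/ffunP => j; rewrite !ffunE; case: eqP => // ->.
  by have := implyP (h i) il => ->.
apply/implyP => jl; rewrite ffunE; case: eqP => // /eqP ji.
rewrite ffunE (negPf ji).
by have := implyP (h j); rewrite inE negb_or ji jl ffunE (negPf ji) => ->.
Qed.

(** Families indexed by [signs n] with values in a module [M], for operators [p]
    that split the identity at each place. They form the product over the places
    [i] of the two-term complexes that send the component at [None] diagonally
    to the ones at [Some true] and [Some false]. *)
Section Cube.
Variables (k : fieldType) (n : nat) (M : lmodType k).
Variable p : 'I_n -> bool -> M -> M.
Hypothesis pL : forall i b, linear (p i b).
Hypothesis pD : forall i x, p i true x + p i false x = x.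
Implicit Types (s : signs n) (i j : 'I_n) (f g : signs n -> M) (l : seq 'I_n).

Definition sgn s i : k := (-1) ^+ zeros_after s i.

Definition cbd f s : M := \sum_(i | s i != None) sgn s i *: f (upd s i None).

(** In the [i]-th factor, [aug i] is the augmentation [f_+ - f_-] and [aproj i] is
    its composite with the section [w |-> (p_i^+ w, - p_i^- w)]; [htpy i] is the
    contraction [(f_+, f_-) |-> p_i^- f_+ + p_i^+ f_-], with the sign that [cbd]
    carries. *)
Definition aug i f s : M := f (upd s i (Some true)) - f (upd s i (Some false)).

Definition aproj i f s : M :=
  if s i is Some b then sg k b *: p i b (aug i f s) else 0.

Definition htpy i f s : M :=
  if s i is Some b then 0 else
    sgn s i *: (p i false (f (upd s i (Some true)))
                + p i true (f (upd s i (Some false)))).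

Lemma sgn_upd_id s i e : sgn (upd s i e) i = sgn s i.
Proof. by have := zeros_after_upd s i i e; rewrite /sgn ltnn !mul0n !addn0 => ->. Qed.

Lemma sgn_upd s i j e : (s i == None) = (e == None) -> sgn (upd s i e) j = sgn s j.
Proof. by move=> E; have := zeros_after_upd s i j e; rewrite /sgn E => /addIn ->. Qed.

(** The Koszul rule: turning [s_i] and [s_j] into zeros in the two possible orders
    gives opposite signs, as exactly one of [i < j] and [j < i] holds. *)
Lemma sgn_swap s i j b : i != j -> s i = None -> s j != None ->
  sgn s j * sgn (upd s j None) i = - (sgn s i * sgn (upd s i (Some b)) j).
Proof.
move=> ij si sj; rewrite /sgn -!exprD -[RHS]mulN1r -exprS.
rewrite -[LHS]signr_odd -[RHS]signr_odd; congr (_ ^+ nat_of_bool _).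
have := zeros_after_upd s i j (Some b); have := zeros_after_upd s j i None.
have : ((i < j) + (j < i) = 1)%N.
  by case: ltngtP => // /val_inj E; rewrite E eqxx in ij.
rewrite si eqxx (negPf sj) !muln1 !muln0 !addn0 => H -> E.
lia.
Qed.

Lemma sgn2 s i (x : M) : sgn s i *: (sgn s i *: x) = x.
Proof. by rewrite scalerA -exprD addnn -signr_odd odd_double scale1r. Qed.

(** The directions other than [i] cancel by [sgn_swap]; in the direction [i], what
    remains is [p_i^+ + p_i^- = id] when [s_i] is zero, and the contraction of a
    single factor otherwise. *)
Lemma htpy_homotopy i f s : cbd (htpy i f) s + htpy i (cbd f) s = f s - aproj i f s.
Proof.
rewrite /aproj /aug; case si: (s i) => [b|].
  rewrite {2}/htpy si addr0 /cbd (bigD1 i) ?si //= big1 => [|j /andP[sj ji]].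
    rewrite addr0 /htpy upd_at sgn_upd_id sgn2 !upd_upd.
    have e : upd s i (Some b) = s by apply: upd_id.
    rewrite -[X in _ = X - _](pD i) (linB (pL i b)).
    by case: b e {si} => ->; rewrite ?scaleN1r ?scale1r; zmod_cancel.
  by rewrite /htpy upd_ne ?si ?scaler0 // eq_sym.
rewrite subr0 /htpy si /cbd.
have E b : \sum_(j | upd s i (Some b) j != None)
      sgn (upd s i (Some b)) j *: f (upd (upd s i (Some b)) j None)
    = sgn s i *: f s + \sum_(j | s j != None)
        sgn (upd s i (Some b)) j *: f (upd (upd s j None) i (Some b)).
  rewrite (bigD1 i) ?upd_at //= upd_upd sgn_upd_id (upd_id si); congr (_ + _).
  apply: eq_big => [j|j /andP[_ ji]].
    by rewrite updE; case: (eqVneq j i) => [->|_]; rewrite ?si ?andbT ?andbF.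
  by rewrite updC // eq_sym.
rewrite !E !(linD (pL _ _)) !(linZ (pL _ _)) !(lin_sum (pL _ _)).
rewrite [X in _ + _ *: X]addrACA -scalerDr [p i false _ + _]addrC pD.
rewrite scalerDr sgn2 addrCA -[RHS]addr0; congr (_ + _).
rewrite scalerDr !scaler_sumr -!big_split big1 //= => j sj.
have ij : i != j by apply: contraNneq sj => <-; rewrite si.
rewrite (upd_ne _ _ ij) si !(linZ (pL _ _)) !scalerDr !scalerA.
have S b : sgn s i * sgn (upd s i (Some b)) j = - (sgn s j * sgn (upd s j None) i).
  by rewrite (sgn_swap b ij si sj) opprK.
by rewrite !S !scaleNr addrACA !subrr addr0.
Qed.

(** In the direction [i], both sides vanish: the family [aproj i f] has no
    components with a zero at [i], and the two faces of [cbd f] in that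
    direction have the same term, which [aug i] kills. *)
Lemma cbd_aproj i f s : cbd (aproj i f) s = aproj i (cbd f) s.
Proof.
rewrite /cbd /aproj; case si: (s i) => [b|]; last first.
  rewrite big1 // => j sj; have ij : i != j by apply: contraNneq sj => <-; rewrite si.
  by rewrite upd_ne // si scaler0.
rewrite (bigD1 i) ?si //= upd_at scaler0 add0r /aug /cbd.
have E c : \sum_(j | upd s i (Some c) j != None)
      sgn (upd s i (Some c)) j *: f (upd (upd s i (Some c)) j None)
    = sgn s i *: f (upd s i None) + \sum_(j | (s j != None) && (j != i))
        sgn s j *: f (upd (upd s j None) i (Some c)).
  rewrite (bigD1 i) ?upd_at //= upd_upd sgn_upd_id; congr (_ + _).
  apply: eq_big => [j|j /andP[_ ji]].
    by rewrite updE; case: (eqVneq j i) => [->|_]; rewrite ?si ?andbT ?andbF.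
  by rewrite sgn_upd ?si // updC // eq_sym.
rewrite !E opprD addrACA subrr add0r -sumrB (lin_sum (pL i b)) scaler_sumr.
apply: eq_bigr => j /andP[sj ji].
rewrite upd_ne 1?eq_sym // si -scalerBr (linZ (pL i b)) !scalerA.
by rewrite mulrC.
Qed.

Definition aprojs l f := foldr aproj f l.

(** With [h_i] for [htpy i] and [e_i] for [aproj i], this is
    [h_1 + e_1 h_2 + e_1 e_2 h_3 + ...], the homotopy of a product of
    retractions. *)
Fixpoint htpys l f s : M :=
  if l is i :: l' then htpy i f s + aproj i (htpys l' f) s else 0.

Lemma aproj_add i f g s : aproj i (fun t => f t + g t) s = aproj i f s + aproj i g s.
Proof.
rewrite /aproj; case: (s i) => [b|]; last by rewrite addr0.
rewrite -scalerDr -(linD (pL i b)); congr (_ *: p i b _).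
by rewrite /aug; zmod_cancel.
Qed.

Lemma aproj_sub i f g s : aproj i (fun t => f t - g t) s = aproj i f s - aproj i g s.
Proof.
rewrite /aproj; case: (s i) => [b|]; last by rewrite subr0.
rewrite -scalerBr -(linB (pL i b)); congr (_ *: p i b _).
by rewrite /aug; zmod_cancel.
Qed.

Lemma aproj_ext i f g s : f =1 g -> aproj i f s = aproj i g s.
Proof. by move=> fg; rewrite /aproj /aug !fg. Qed.

Lemma cbd_add f g s : cbd (fun t => f t + g t) s = cbd f s + cbd g s.
Proof. by rewrite -big_split; apply: eq_bigr => i _; rewrite scalerDr. Qed.

(** Since [aproj i] commutes with the boundary, the terms telescope:
    [(1 - e_1) + e_1 (1 - e_2) + ... = 1 - e_1 e_2 ...]. *)
Lemma htpys_homotopy l f s :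
  cbd (htpys l f) s + htpys l (cbd f) s = f s - aprojs l f s.
Proof.
elim: l f s => [|i l IH] f s /=.
  by rewrite subrr addr0 /cbd big1 // => j _; rewrite scaler0.
rewrite cbd_add cbd_aproj addrACA htpy_homotopy -aproj_add.
by rewrite (aproj_ext _ _ (IH f)) aproj_sub addrA addrNK.
Qed.

Definition augs l f := foldr aug f l.

Definition caug f : M :=
  \sum_(g : {ffun 'I_n -> bool}) (\prod_i sg k (g i)) *: f [ffun i => Some (g i)].

(** [caug] is the boundary from degree one to degree zero; the lemma expands the
    iterated differences, so that it can be compared with [aprojs]. *)
Lemma augsE f s : augs (enum 'I_n) f s = caug f.
Proof.
pose op i b f s : M := sg k b *: f (upd s i (Some b)).
have opD i b : {morph op i b : f g / f + g}.
  by move=> g h; apply/funext => t; rewrite /op scalerDr.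
rewrite /augs (_ : aug = fun i g => op i true g + op i false g); last first.
  apply/funext => i; apply/funext => g; apply/funext => t.
  by rewrite /aug -[RHS]/(_ + _) /op scale1r scaleN1r.
rewrite foldr_sum_choices // fct_sumE; apply: eq_bigr => g _.
have E l t : foldr (fun i f => op i (g i) f) f l t = (\prod_(i <- l) sg k (g i)) *:
    f [ffun i => if i \in l then Some (g i) else t i].
  elim: l t => [|i l IH] t /=.
    by rewrite big_nil scale1r; congr f; apply/ffunP => i; rewrite ffunE.
  rewrite /op IH big_cons scalerA; congr (_ *: f _); apply/ffunP => j.
  by rewrite !ffunE inE; case: (eqVneq j i) => [->|]; case: ifP.
rewrite E big_enum; congr (_ *: f _); apply/ffunP => i.
by rewrite !ffunE mem_enum.
Qed.

(** The section of the augmentation at all the places of [l] together. *)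
Definition sproj l s (x : M) : M :=
  foldr (fun i y => if s i is Some b then sg k b *: p i b y else 0) x l.

Lemma sprojL l s : linear (sproj l s).
Proof.
elim: l => [|i l IH] a x y //=; rewrite IH.
case: (s i) => [b|]; last by rewrite scaler0 addr0.
by rewrite (pL i b) scalerDr !scalerA [a * _]mulrC.
Qed.

Lemma sproj_upd l s i e x : i \notin l -> sproj l (upd s i e) x = sproj l s x.
Proof.
elim: l => //= j l IH; rewrite inE negb_or => /andP[ij il].
by rewrite IH // upd_ne // eq_sym.
Qed.

Lemma aprojsE l f s : uniq l -> aprojs l f s = sproj l s (augs l f s).
Proof.
elim: l s => //= i l IH s /andP[il ul]; rewrite /aproj.
case: (s i) => // b; congr (_ *: p i b _).
by rewrite /aug !IH // !sproj_upd // (linB (sprojL l s)).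
Qed.

(** Augmenting undoes the section because [p_i^+ + p_i^- = id]. The map [Phi] in
    between will be a differential, which does not commute with the [p_i];
    it only has to be the same at all the signs that are summed. *)
Lemma augs_sproj (Phi : signs n -> M -> M) l x s :
  (forall t, linear (Phi t)) ->
  (forall t i b, i \in l -> Phi (upd t i (Some b)) = Phi t) ->
  uniq l -> augs l (fun t => Phi t (sproj l t x)) s = Phi s x.
Proof.
elim: l Phi s => //= i l IH Phi s Phil Phiu /andP[il ul].
pose Psi t y := Phi t (if t i is Some b then sg k b *: p i b y else 0).
have PsiL t : linear (Psi t).
  move=> a y z; rewrite /Psi; case: (t i) => [b|].
    by rewrite -Phil (pL i b) scalerDr !scalerA [a * _]mulrC.
  by rewrite !(lin0 (Phil t)) scaler0 addr0.
have PsiU t j b : j \in l -> Psi (upd t j (Some b)) = Psi t.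
  move=> jl; apply/funext => y; rewrite /Psi Phiu ?inE ?jl ?orbT // upd_ne //.
  by apply: contraNneq il => ->.
rewrite /aug !(IH Psi) // /Psi !upd_at !Phiu ?mem_head // -(linB (Phil s)).
by rewrite scale1r scaleN1r opprK pD.
Qed.

Lemma caug_sproj (Phi : M -> M) x : linear Phi ->
  caug (fun t => Phi (sproj (enum 'I_n) t x)) = Phi x.
Proof.
move=> Phil; rewrite -(augsE _ [ffun=> None]).
by rewrite (@augs_sproj (fun=> Phi)) // enum_uniq.
Qed.

Lemma augs_sub l f g s : augs l (fun t => f t - g t) s = augs l f s - augs l g s.
Proof.
by elim: l s => //= i l IH s; rewrite /aug !IH; zmod_cancel.
Qed.

(** For families that are only known at the components that [augs] reads. *)
Lemma augs_ext l f g s :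
  (forall t : signs n, (forall i, i \in l -> t i != None) ->
             (forall i, i \notin l -> t i = s i) -> f t = g t) ->
  augs l f s = augs l g s.
Proof.
elim: l s => [|i l IH] s fg /=; first by apply: fg.
have E b : augs l f (upd s i (Some b)) = augs l g (upd s i (Some b)).
  apply: IH => t tl ts; case: (boolP (i \in l)) => il.
    apply: fg => j; rewrite inE; first by case/predU1P => [->|]; apply: tl.
    by rewrite negb_or => /andP[ji jl]; rewrite ts // upd_ne.
  apply: fg => j; rewrite inE.
    by case/predU1P => [->|/tl //]; rewrite ts // upd_at.
  by rewrite negb_or => /andP[ji jl]; rewrite ts // upd_ne.
by rewrite /aug !E.
Qed.

(** At a given [s], a single summand of [htpys] survives: a contraction at a place
    where [s] is not zero vanishes, and so does every summand that contains
    [aproj i] for a zero [i] of [s]. *)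
Lemma htpys_first_zero l i r f s : s i = None -> (forall j, j \in l -> s j != None) ->
  htpys (l ++ i :: r) f s = aprojs l (htpy i f) s.
Proof.
elim: l s => [|j l IH] s si sl /=.
  by rewrite /aproj si addr0.
have sj : s j != None by apply: sl; rewrite mem_head.
have ij : i != j by apply: contraNneq sj => <-; rewrite si.
have E b : htpys (l ++ i :: r) f (upd s j (Some b))
         = aprojs l (htpy i f) (upd s j (Some b)).
  apply: IH => [|m ml]; first by rewrite upd_ne.
  by rewrite updE; case: ifP => // _; apply: sl; rewrite inE ml orbT.
rewrite {1}/htpy; case: (s j) sj E => [b _|//] E.
by rewrite add0r /aproj /aug !E.
Qed.

(** Families that are concentrated in degree [q] of the complex. *)
Definition supported q f := forall s, sdeg s != q -> f s = 0.

Lemma aproj_supported q i f : supported q f -> supported q (aproj i f).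
Proof.
move=> fq s sq; rewrite /aproj; case si: (s i) => [b|//].
have fi c : f (upd s i (Some c)) = 0.
  by apply: fq; have := sdeg_upd s i (Some c); rewrite si !addn0 => ->.
by rewrite /aug !fi subrr (lin0 (pL i b)) scaler0.
Qed.

Lemma htpy_supported q i f : supported q f -> supported q.+1 (htpy i f).
Proof.
move=> fq s sq; rewrite /htpy; case si: (s i) => [b//|].
have fi c : f (upd s i (Some c)) = 0.
  apply: fq; have := sdeg_upd s i (Some c); rewrite si eqxx addn0 => E.
  by apply: contraNneq sq => <-; rewrite -E addn1.
by rewrite !fi !(lin0 (pL _ _)) addr0 scaler0.
Qed.

Lemma htpys_supported q l f : supported q f -> supported q.+1 (htpys l f).
Proof.
move=> fq; elim: l => [|i l IH] s sq //=.
by rewrite (htpy_supported i fq) // (aproj_supported i IH) // addr0.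
Qed.

Lemma cbd_supported1 f s : supported 1 f -> cbd f s = 0.
Proof.
move=> f1; rewrite /cbd big1 // => i si; rewrite f1 ?scaler0 //.
have := sdeg_upd s i None; rewrite (negPf si) eqxx addn0 addn1 => ->.
by rewrite /sdeg.
Qed.

Lemma caug_supported q f : (1 < q)%N -> supported q f -> caug f = 0.
Proof.
move=> q1 fq; rewrite /caug big1 // => g _; rewrite fq ?scaler0 //.
rewrite /sdeg (_ : #|_| = 0)%N; first by case: q q1 {fq} => [|[]].
by apply: eq_card0 => i; rewrite inE ffunE.
Qed.

Lemma sproj_none l s i x : i \in l -> s i = None -> sproj l s x = 0.
Proof.
elim: l => //= j l IH; rewrite inE => /orP[/eqP <- ->//|il si].
by rewrite (IH il si); case: (s j) => // b; rewrite (lin0 (pL j b)) scaler0.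
Qed.

Lemma sproj_supported1 x : supported 1 (fun s => sproj (enum 'I_n) s x).
Proof.
move=> s; rewrite /sdeg -[X in _ != X]addn0 eqn_add2l -lt0n => /card_gt0P[i].
by rewrite inE => /eqP; apply: sproj_none; rewrite mem_enum.
Qed.

Lemma sdeg_le s : (sdeg s <= n.+1)%N.
Proof. by rewrite /sdeg ltnS -[X in (_ <= X)%N]card_ord max_card. Qed.

Lemma cube_exact f : cbd f =1 (fun=> 0) -> caug f = 0 ->
  cbd (htpys (enum 'I_n) f) =1 f.
Proof.
move=> df ef s; have := htpys_homotopy (enum 'I_n) f s.
rewrite aprojsE ?enum_uniq // augsE ef (lin0 (sprojL _ _)) subr0 => <-.
rewrite [X in _ = _ + X](_ : _ = 0) ?addr0 //.
elim: (enum 'I_n) s => //= i l IH s; rewrite /htpy /aproj /aug !df !IH.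
by case: (s i) => [b|]; rewrite ?subrr ?(lin0 (pL _ _)) ?scaler0 ?addr0 ?scaler0.
Qed.

(** [Y Q] stands for the part of [M] that belongs to all the pairs of a place and
    a sign in [Q]. Indexing the parts by sets of pairs, rather than by elements of
    [signs n], lets the one hypothesis [Yp] cover all components. *)
Section Membership.
Variable Y : ('I_n -> bool -> bool) -> set M.
Hypothesis Y0 : forall Q, Y Q 0.
Hypothesis YL : forall Q a x y, Y Q x -> Y Q y -> Y Q (a *: x + y).
Hypothesis Yle : forall (Q Q' : 'I_n -> bool -> bool) x,
  (forall i b, Q' i b -> Q i b) -> Y Q x -> Y Q' x.
Hypothesis Yp : forall (Q : 'I_n -> bool -> bool) i b x,
  Y Q x -> Y (fun j c => Q j c || (j == i) && (c == b)) (p i b x).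

Definition in_parts f := forall s, Y (sides s) (f s).

Lemma Yscale Q a x : Y Q x -> Y Q (a *: x).
Proof. by move=> h; rewrite -[_ *: _]addr0; apply: YL. Qed.

Lemma Yadd Q x y : Y Q x -> Y Q y -> Y Q (x + y).
Proof. by move=> h; rewrite -[x]scale1r; apply: YL. Qed.

Lemma Ysub Q x y : Y Q x -> Y Q y -> Y Q (x - y).
Proof. by move=> hx hy; rewrite -scaleN1r addrC; apply: YL. Qed.

Lemma sproj_in_parts x :
  Y (fun _ _ => false) x -> in_parts (fun s => sproj (enum 'I_n) s x).
Proof.
move=> Yx s.
have h l : Y (fun i b => (i \in l) && sides s i b) (sproj l s x).
  elim: l => [|i l IH] //=; case si: (s i) => [b|]; last exact: Y0.
  apply: Yscale; apply: Yle (Yp i b IH) => j c; rewrite inE.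
  case/andP => /orP[/eqP ->|jl] sj; last by rewrite jl sj.
  by move: sj; rewrite /sides si /= eqxx orbC => /eqP[->]; rewrite eqxx.
by apply: Yle (h (enum 'I_n)) => i b sb; rewrite mem_enum.
Qed.

Lemma aproj_in_parts i f : in_parts f -> in_parts (aproj i f).
Proof.
move=> fT s; rewrite /aproj; case si: (s i) => [b|]; last exact: Y0.
have h c : Y (sides s) (p i b (f (upd s i (Some c)))).
  apply: Yle (Yp i b (fT (upd s i (Some c)))) => j d.
  rewrite /sides updE; case: (eqVneq j i) => [->|_] /=; last by rewrite orbF.
  by rewrite si => /eqP[->]; rewrite eqxx orbT.
by apply: Yscale; rewrite /aug (linB (pL i b)); apply: Ysub.
Qed.

Lemma htpy_in_parts i f : in_parts f -> in_parts (htpy i f).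
Proof.
move=> fT s; rewrite /htpy; case si: (s i) => [b|]; first exact: Y0.
have h c : Y (sides s) (p i (~~ c) (f (upd s i (Some c)))).
  apply: Yle (Yp i (~~ c) (fT (upd s i (Some c)))) => j d.
  rewrite /sides updE; case: (eqVneq j i) => [_ _|_] /=; last by rewrite orbF.
  by case: c d => -[].
by apply: Yscale; apply: Yadd; [apply: (h true)|apply: (h false)].
Qed.

Lemma htpys_in_parts l f : in_parts f -> in_parts (htpys l f).
Proof.
move=> fT; elim: l => [|i l IH] s /=; first exact: Y0.
by apply: Yadd; [apply: htpy_in_parts|apply: aproj_in_parts].
Qed.

End Membership.

End Cube.

Section CubeMaps.
Variables (k : fieldType) (n : nat).

Lemma cbd_lin (M N : lmodType k) (F : M -> N) (f : signs n -> M) s : linear F ->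
  cbd (fun t => F (f t)) s = F (cbd f s).
Proof.
by move=> Fl; rewrite (lin_sum Fl); apply: eq_bigr => i _; rewrite (linZ Fl).
Qed.

Lemma caug_lin (M N : lmodType k) (F : M -> N) (f : signs n -> M) : linear F ->
  caug (fun t => F (f t)) = F (caug f).
Proof.
by move=> Fl; rewrite (lin_sum Fl); apply: eq_bigr => i _; rewrite (linZ Fl).
Qed.

Lemma cbd_sub (M : lmodType k) (f g : signs n -> M) s :
  cbd (fun t => f t - g t) s = cbd f s - cbd g s.
Proof. by rewrite -sumrB; apply: eq_bigr => i _; rewrite scalerBr. Qed.

Lemma caug_sub (M : lmodType k) (f g : signs n -> M) :
  caug (fun t => f t - g t) = caug f - caug g.
Proof. by rewrite -sumrB; apply: eq_bigr => i _; rewrite scalerBr. Qed.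

End CubeMaps.

(** * Ideals of infinite matrices and their local units *)

Section Ideals.
Implicit Type R : nzRingType.

Definition two_sided R (J : set R) : Prop :=
  [/\ J 0, forall x y, J x -> J y -> J (x + y),
      forall x y, J y -> J (x * y) & forall x y, J x -> J (x * y)].

Lemma two_sidedN R (J : set R) x : two_sided J -> J x -> J (- x).
Proof. by case=> _ _ Jl _ Jx; rewrite -mulN1r; apply: Jl. Qed.

Lemma two_sided_sum R (J : set R) I (r : seq I) (P : pred I) (F : I -> R) :
  two_sided J -> (forall i, P i -> J (F i)) -> J (\sum_(i <- r | P i) F i).
Proof. by case=> J0 JD _ _ JF; apply: big_ind. Qed.

Lemma two_sided_setT R : two_sided (@setT R). Proof. by []. Qed.

Lemma imatME R (x y : imat R) i j K :
  (forall l, (K < `|i - l|)%N -> x i l = 0) ->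
  (x * y) i j = \sum_(l <- win i K) x i l * y l j.
Proof. exact: imatM_win. Qed.

Lemma two_sided_Ipm R s : two_sided (@Ipm R s).
Proof.
split=> [|x y [B hx] [C hy]|x y [B hy]|x y [B hx]].
- by exists 0.
- exists (if s then Order.min B C else Order.max B C) => i j h /=.
  rewrite hx ?hy ?addr0 //; case: s {hx hy} h => /=.
  + by rewrite lt_min => /andP[].
  + by rewrite gt_max => /andP[].
  + by rewrite lt_min => /andP[].
  + by rewrite gt_max => /andP[].
- have [K hK] := imat_banded x.
  exists (if s then B - K%:Z else B) => i j h.
  rewrite (@imatME _ _ _ _ _ K); last by move=> l; apply: hK.
  rewrite big_seq big1 // => l; rewrite mem_win => il; rewrite hy ?mulr0 //.
  by case: s {hy} h; lia.
- have [K hK] := imat_banded y.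
  have [L hL] := imat_banded x.
  exists (if s then B else B + K%:Z) => i j h.
  rewrite (@imatME _ _ _ _ _ L); last by move=> l; apply: hL.
  rewrite big1 // => l _; have [lj|lj] := ltnP K `|l - j|%N.
    by rewrite hK ?mulr0.
  by rewrite hx ?mul0r //; case: s {hx} h; lia.
Qed.

Lemma two_sided_Esub R (J : set R) : two_sided J -> two_sided (Esub J).
Proof.
move=> Jt; have [J0 JD Jl Jr] := Jt.
split=> [|x y hx hy|x y hy|x y hx] i j.
- exact: J0.
- exact: JD (hx i j) (hy i j).
- have [K hK] := imat_banded x.
  rewrite (@imatME _ _ _ _ _ K); last by move=> l; apply: hK.
  by apply: two_sided_sum => // l _; apply: Jl.
- have [K hK] := imat_banded x.
  rewrite (@imatME _ _ _ _ _ K); last by move=> l; apply: hK.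
  by apply: two_sided_sum => // l _; apply: Jr.
Qed.

(** [J] has local left units. *)
Definition unital R (J : set R) : Prop :=
  forall l : seq R, (forall a, a \in l -> J a) ->
  exists2 e, J e & forall a, a \in l -> e * a = a.

(** Units for single elements suffice: if [e a = a], and [e'] is a unit for the
    elements [b - e b], then [1 - (1 - e') (1 - e)] is a unit for [a] and for
    all the [b]. *)
Lemma unitalP R (J : set R) : two_sided J ->
  (forall a, J a -> exists2 e, J e & e * a = a) -> unital J.
Proof.
move=> Jt J1 l; have [J0 JD Jl Jr] := Jt.
have [m sl] := ubnP (size l); elim: m l sl => [//|m IH] [|a l] sl Jal.
  by exists 0.
have [e Je ea] : exists2 e, J e & e * a = a by apply/J1/Jal/mem_head.
have Jb b : b \in l -> J b by move=> bl; apply: Jal; rewrite inE bl orbT.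
have [|b|e' Je' e'b] := IH [seq b - e * b | b <- l]; first by rewrite size_map.
  move=> /mapP[c cl ->]; apply: JD; first exact: Jb.
  by apply: two_sidedN => //; apply/Jl/Jb.
exists (e + e' - e' * e) => [|b].
  by apply: (JD); [apply: JD|apply: two_sidedN => //; apply: Jl].
rewrite inE => /orP[/eqP ->|bl]; rewrite mulrBl mulrDl -mulrA.
  by rewrite ea addrK.
rewrite -addrA -mulrBr (e'b (b - e * b)); first by rewrite addrC subrK.
exact: (map_f (fun b => b - e * b) bl).
Qed.

Fact diag_subproof R (e : int -> R) : banded (fun i j => if i == j then e i else 0).
Proof. by exists 0%N => i j; case: eqVneq => // ->; rewrite subrr. Qed.

Definition diag R (e : int -> R) : imat R := mk_imat (diag_subproof e).

Lemma diagM R (e : int -> R) (x : imat R) i j : (diag e * x) i j = e i * x i j.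
Proof.
rewrite (@imatME _ _ _ _ _ 0%N) => [|l /=].
  by rewrite /win big_seq1 /= subr0 addr0 eqxx.
by case: eqVneq => // ->; rewrite subrr.
Qed.

Lemma unital_Ipm R s : unital (@Ipm R s).
Proof.
apply: unitalP => [|x [B hx]]; first exact: two_sided_Ipm.
have [K hK] := imat_banded x.
pose u (i : int) := if s then (B <= i)%R else (i <= B + K%:Z)%R.
exists (diag (fun i => (u i)%:R)).
  exists (if s then B else B + K%:Z) => i j h /=; case: eqVneq h => // <-.
  by rewrite /u; case: s {u hx} => h; rewrite lt_geF.
apply: imatP => i j; rewrite diagM /u; case: s hx {u} => hx.
  by have [h|h] := lerP B i; rewrite ?mul1r // hx ?mul0r.
have [h|h] := lerP i (B + K%:Z); rewrite ?mul1r // mul0r.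
have [ij|ij] := ltnP K `|i - j|%N; first by rewrite hK.
by rewrite hx //; lia.
Qed.

(** The entries of a matrix over [J] need not have a common unit, but each row has
    one, since it has finitely many nonzero entries; the units of the rows are
    the diagonal of a unit of the matrix. *)
Lemma unital_Esub R (J : set R) : two_sided J -> unital J -> unital (Esub J).
Proof.
move=> Jt Ju; apply: unitalP => [|x Jx]; first exact: two_sided_Esub.
have [K hK] := imat_banded x.
have h i : exists e, J e /\ forall j, e * x i j = x i j.
  have [|e Je eb] := Ju [seq x i j | j <- win i K]; first by move=> _ /mapP[j _ ->].
  exists e; split=> // j; have [ij|ij] := ltnP K `|i - j|%N.
    by rewrite hK // mulr0.
  by apply/eb/map_f; rewrite mem_win.
have [e he] := choice h; exists (diag e) => [i j /=|].
  by case: eqP => _; [case: (he i)|case: Jt].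
by apply: imatP => i j; rewrite diagM; case: (he i).
Qed.

End Ideals.

(** * The iterated trace *)

Section MatrixIdeals.
Variable k : fieldType.

Lemma two_sided_Iat n i s : two_sided (@Iat k n i s).
Proof.
elim: n => [|n IH] /=; first exact: two_sided_setT.
by case: eqP => _; [apply: two_sided_Ipm|apply: two_sided_Esub].
Qed.

Lemma unital_Iat n i s : unital (@Iat k n i s).
Proof.
elim: n => [|n IH] /=.
  by apply: unitalP => // a _; exists 1 => //; rewrite mul1r.
case: eqP => _; first exact: unital_Ipm.
by apply: unital_Esub => //; apply: two_sided_Iat.
Qed.

Lemma Itr_two_sided n : two_sided (Itr k n).
Proof.
split=> [|x y hx hy|x y hy|x y hx] i s;
  have [J0 JD Jl Jr] := two_sided_Iat n i s; auto.
Qed.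

(** At each place, one of the two matrices is bounded below and one is bounded
    above. This is what makes the sums in the traces of both products finite. *)
Definition complementary n (a b : Epow k n) : Prop :=
  forall (i : 'I_n) s, Iat i s a \/ Iat i s b.

Lemma complementary_sym n (a b : Epow k n) : complementary a b -> complementary b a.
Proof. by move=> h i s; case: (h i s); [right|left]. Qed.

Lemma Itr_complementary n (a b : Epow k n) : complementary a b -> Itr k n (a * b).
Proof.
move=> h i s; have [J0 JD Jl Jr] := two_sided_Iat n i s.
by case: (h i s); [apply: Jr|apply: Jl].
Qed.

Lemma complementary_entry n (a b : Epow k n.+1) : complementary a b ->
  forall i j i' j', @complementary n ((a : imat _) i j) ((b : imat _) i' j').
Proof.
move=> h i j i' j' l s; have := h (widen_ord (leqnSn n) l) s.
by rewrite /= (ltn_eqF (ltn_ord l)) => -[] hl; [left|right]; apply: hl.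
Qed.

Lemma Itr_entry n (a : Epow k n.+1) : Itr k n.+1 a ->
  forall i j, Itr k n ((a : imat _) i j).
Proof.
move=> h i j l s; have := h (widen_ord (leqnSn n) l) s.
by rewrite /= (ltn_eqF (ltn_ord l)) => hl; apply: hl.
Qed.

Lemma Ipm_pair (R : nzRingType) (a b : imat R) :
  (forall s, Ipm s a \/ Ipm s b) -> exists N : nat, forall i l,
  (N < `|i|)%N || (N < `|l|)%N -> a i l = 0 \/ b l i = 0.
Proof.
move=> h; have [K hK] := imat_banded a.
have near i l : (K < `|i - l|)%N \/ (`|i - l| <= K)%N by case: ltnP; [left|right].
have [B hB] : exists B : int, forall i l, (i < B)%R || (l < B)%R ->
    a i l = 0 \/ b l i = 0.
  case: (h true) => -[B hB]; exists (B - K%:Z) => i l il;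
    (have [K_il|il_K] := near i l; first by left; apply: hK);
    [left|right]; apply: hB; lia.
have [C hC] : exists C : int, forall i l, (C < i)%R || (C < l)%R ->
    a i l = 0 \/ b l i = 0.
  case: (h false) => -[C hC]; exists (C + K%:Z) => i l il;
    (have [K_il|il_K] := near i l; first by left; apply: hK);
    [left|right]; apply: hC; lia.
exists (`|B| + `|C|)%N => i l N_il.
have [lo|lo] := boolP ((i < B)%R || (l < B)%R); first exact: hB.
apply: hC; move: lo; rewrite negb_or -!leNgt; lia.
Qed.

Lemma tau_window n (x : Epow k n.+1) (r : seq int) : uniq r ->
  (forall i, i \notin r -> (x : imat _) i i = 0) ->
  tau x = tau (\sum_(i <- r) (x : imat (Epow k n)) i i).
Proof.
move=> ur hr; rewrite /= (fsbigE r) //=; last by move=> i _; apply: hr.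
by congr tau; apply: eq_bigl => i; rewrite in_setT.
Qed.

Lemma win0_out N i : i \notin win 0 N -> (N < `|i|)%N.
Proof. by rewrite mem_win sub0r abszN -ltnNge. Qed.

Lemma Itr_diag n (x : Epow k n.+1) : Itr k n.+1 x ->
  exists N : nat, forall i, (N < `|i|)%N -> (x : imat (Epow k n)) i i = 0.
Proof.
(* The diagonal entry of [x] at [i] is paired with the one of the unit matrix,
   which does not vanish. *)
move=> hx; have [|N hN] := @Ipm_pair (Epow k n) x 1.
  by move=> s; left; have := hx ord_max s; rewrite /= eqxx.
exists N => i Ni; case: (hN i i) => // [|/eqP]; first by rewrite Ni.
by rewrite /= eqxx oner_eq0.
Qed.

(** The hypotheses make the sums of diagonal entries finite at each level, and
    a common window then serves both sums. *)
Lemma tauD n (x y : Epow k n) :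
  Itr k n x -> Itr k n y -> tau (x + y) = tau x + tau y.
Proof.
elim: n x y => [//|n IH] x y hx hy.
have [N hN] := Itr_diag hx; have [L hL] := Itr_diag hy.
have out i : i \notin win 0 (N + L) -> (N < `|i|)%N /\ (L < `|i|)%N.
  by move=> /win0_out; lia.
rewrite !(@tau_window _ _ (win 0 (N + L))) ?win_uniq //.
- rewrite -IH -?big_split //; apply: two_sided_sum => [|i _];
    by [apply: Itr_two_sided|apply: Itr_entry].
- by move=> i /out[_ /hL].
- by move=> i /out[/hN].
- by move=> i /out[/hN xi /hL yi]; rewrite -[LHS]/(_ + _) xi yi addr0.
Qed.

Lemma tau0 n : tau (0 : Epow k n) = 0.
Proof.
have [J0 _ _ _] := Itr_two_sided n.
by apply: (@addrI _ (tau (0 : Epow k n))); rewrite -tauD // !addr0.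
Qed.

Lemma tau_sum n I (r : seq I) (F : I -> Epow k n) :
  (forall i, Itr k n (F i)) -> tau (\sum_(i <- r) F i) = \sum_(i <- r) tau (F i).
Proof.
move=> hF; elim: r => [|i r IH]; first by rewrite !big_nil tau0.
rewrite !big_cons tauD ?IH //; apply: two_sided_sum => //.
exact: Itr_two_sided.
Qed.

(** At each level both traces are finite double sums over one window, which can be
    exchanged; the innermost entries commute. *)
Lemma tau_mulC n (a b : Epow k n) : complementary a b -> tau (a * b) = tau (b * a).
Proof.
elim: n a b => [|n IH] a b hab; first by rewrite [a * b]mulrC.
have [N hN] : exists N : nat, forall i l, (N < `|i|)%N || (N < `|l|)%N ->
    (a : imat (Epow k n)) i l = 0 \/ (b : imat (Epow k n)) l i = 0.
  by apply: Ipm_pair => s; have := hab ord_max s; rewrite /= eqxx.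
have out i l : (i \notin win 0 N) || (l \notin win 0 N) ->
    (a : imat (Epow k n)) i l = 0 \/ (b : imat (Epow k n)) l i = 0.
  by case/orP => /win0_out h; apply: hN; rewrite h ?orbT.
have E (c d : imat (Epow k n)) : complementary (c : Epow k n.+1) d ->
    (forall i l, (i \notin win 0 N) || (l \notin win 0 N) -> c i l = 0 \/ d l i = 0) ->
    tau (c * d : Epow k n.+1) =
    \sum_(i <- win 0 N) \sum_(l <- win 0 N) tau (c i l * d l i).
  move=> hcd ocd.
  have zero i l : (i \notin win 0 N) || (l \notin win 0 N) -> c i l * d l i = 0.
    by move=> /ocd[] ->; rewrite ?mul0r ?mulr0.
  have cdE i : (c * d) i i = \sum_(l <- win 0 N) c i l * d l i.
    rewrite -[LHS]/(\sum_(l \in _) _) (fsbigE (win 0 N)) ?win_uniq //.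
      by apply: eq_bigl => l; rewrite in_setT.
    by move=> l _ lN; apply: zero; rewrite lN orbT.
  have hl i l : Itr k n (c i l * d l i).
    by apply: Itr_complementary; apply: complementary_entry.
  rewrite (@tau_window _ _ (win 0 N)) ?win_uniq //; last first.
    by move=> i iN; rewrite cdE big1 // => l _; apply: zero; rewrite iN.
  rewrite tau_sum => [|i]; last first.
    by rewrite cdE; apply: two_sided_sum => //; apply: Itr_two_sided.
  by apply: eq_bigr => i _; rewrite cdE tau_sum.
rewrite !E //; last 2 first.
- exact: complementary_sym.
- by move=> i l; rewrite orbC => /out[]; [right|left].
rewrite exchange_big; apply: eq_bigr => i _; apply: eq_bigr => l _.
by apply: IH; apply: complementary_entry.
Qed.

Lemma tau_br n (a b : Epow k n) : complementary a b -> tau (br a b) = 0.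
Proof.
move=> hab; have hba := complementary_sym hab.
apply: (@addIr _ (tau (b * a))); rewrite -tauD.
- by rewrite add0r subrK tau_mulC.
- have J := Itr_two_sided n; have [_ JD _ _] := J.
  rewrite /br; apply: JD; first exact: Itr_complementary.
  by apply: (two_sidedN J); apply: Itr_complementary.
- exact: Itr_complementary.
Qed.

End MatrixIdeals.

(** * The exterior algebra and its ideal parts *)

Section Spans.
Variables (k : fieldType) (V W : lmodType k).

Lemma lspan_map (S : set V) (T : set W) (F : V -> W) : linear F ->
  (forall x, S x -> lspan T (F x)) -> forall v, lspan S v -> lspan T (F v).
Proof.
move=> Fl ST _ [l lS ->]; rewrite (lin_sum Fl).
elim: l lS => [|x l IH] lS; first by rewrite big_nil; apply: lspan0.
rewrite big_cons; apply: lspanD; last first.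
  by apply: IH => y yl; apply: lS; rewrite inE yl orbT.
by rewrite (linZ Fl); apply/lspanZ/ST/lS/mem_head.
Qed.

Lemma lspan_sum (S : set V) I (r : seq I) (P : pred I) (F : I -> V) :
  (forall i, P i -> lspan S (F i)) -> lspan S (\sum_(i <- r | P i) F i).
Proof. by apply: big_ind; [apply: lspan0|apply: lspanD]. Qed.

Lemma lspanN (S : set V) v : lspan S v -> lspan S (- v).
Proof. by rewrite -scaleN1r; apply: lspanZ. Qed.

End Spans.

Section ExtPower.
Variables (k : fieldType) (A : algType k).
Implicit Types (J : set A) (u x y : A) (s g : seq A) (w : ext A).

Lemma ce_wedge J x g : J x -> ce J (size g).+1 (wedge (x :: g)).
Proof. by move=> Jx; apply: sub_lspan; exists x, g. Qed.

Lemma extp_wedge s : extp (size s) (wedge s).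
Proof. by apply: sub_lspan; exists s. Qed.

Lemma ce_extp J r w : ce J r w -> extp r w.
Proof.
case: r => [//|r]; apply: (@lspan_map _ _ _ _ _ id) => // _ [x [g [_ <- ->]]].
exact: (extp_wedge (x :: g)).
Qed.

Lemma ce_linear J r a w w' : ce J r w -> ce J r w' -> ce J r (a *: w + w').
Proof. by case: r => [|r] h h'; apply: lspanD => //; apply: lspanZ. Qed.

Lemma ce_wcons J y r w : ce J r.+1 w -> ce J r.+2 (wcons y w).
Proof.
apply: lspan_map; first exact: wconsL.
move=> _ [x [g [Jx <- ->]]]; rewrite -wcons_wedge wconsC; apply: lspanN.
by rewrite !wcons_wedge; apply: (ce_wedge (y :: g)).
Qed.

Lemma ce_wcons_ideal J x r w : J x -> extp r w -> ce J r.+1 (wcons x w).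
Proof.
move=> Jx; apply: lspan_map; first exact: wconsL.
by move=> _ [g <- ->]; rewrite wcons_wedge; apply: ce_wedge.
Qed.

(** The algebra endomorphism induced by left multiplication by [u] on vectors, not
    the exterior multiplication by [u]. *)
Definition left_mul u : ext A -> ext A :=
  plift (fun s => wedge [seq u * x | x <- s]).

Fact left_mul_rel u r : @ext_rel k A r ->
  fglift (fun s => wedge [seq u * x | x <- s]) r = 0.
Proof.
apply: ext_rel_lift => [s t a x y|s t x]; rewrite !map_cat /=.
  by rewrite mulrDr -scalerAr wedge_linear.
by rewrite wedge_alternating.
Qed.

Lemma left_mulL u : linear (left_mul u).
Proof. exact: plift_linear (@left_mul_rel u). Qed.

Lemma left_mul_wedge u s : left_mul u (wedge s) = wedge [seq u * x | x <- s].
Proof. exact: plift_gen (@left_mul_rel u) _. Qed.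

Lemma extp_left_mul u r w : extp r w -> extp r (left_mul u w).
Proof.
apply: lspan_map; first exact: left_mulL.
move=> _ [s <- ->]; rewrite left_mul_wedge -(size_map ( *%R u)).
exact: extp_wedge.
Qed.

Lemma ce_left_mul J u r w : (forall x, J x -> J (u * x)) ->
  ce J r.+1 w -> ce J r.+1 (left_mul u w).
Proof.
move=> Ju; apply: lspan_map; first exact: left_mulL.
move=> _ [x [g [Jx <- ->]]]; rewrite left_mul_wedge -(size_map ( *%R u)).
by apply: ce_wedge; apply: Ju.
Qed.

Lemma ce_left_mul_into J u r w : (forall x, J (u * x)) ->
  extp r.+1 w -> ce J r.+1 (left_mul u w).
Proof.
move=> Ju; apply: lspan_map; first exact: left_mulL.
move=> _ [[|x g] // [<-] ->]; rewrite left_mul_wedge -(size_map ( *%R u)).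
exact: ce_wedge.
Qed.

(** Replacing the letters of a word by their products with [u] one at a time, each
    step changes the word by one that has a letter [(1 - u) x]. *)
Lemma ce_sub_left_mul J u r w : (forall x, J ((1 - u) * x)) ->
  extp r.+1 w -> ce J r.+1 (w - left_mul u w).
Proof.
move=> Ju; apply: (@lspan_map _ _ _ _ _ (fun v => v - left_mul u v)).
  exact: linear_sub (@linear_id _ _) (left_mulL u).
move=> _ [[|x g] // [<-] ->]; rewrite left_mul_wedge -[size g]/(size g).
elim: g x => [|y g IH] x /=.
  have := linB (wedge_cons_linear [::]) x (u * x) => <-.
  by rewrite -{1}[x]mul1r -mulrBl; apply: (@ce_wedge J _ [::]).
have -> : wedge [:: x, y & g] - wedge [:: u * x, u * y & [seq u * z | z <- g]] =
    wedge [:: (1 - u) * x, y & g]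
    + wcons (u * x) (wedge (y :: g) - wedge (u * y :: [seq u * z | z <- g])).
  rewrite mulrBl mul1r (linB (wedge_cons_linear _)) (linB (wconsL _)) !wcons_wedge.
  by rewrite addrA addrNK.
by apply: lspanD; [apply: (@ce_wedge J _ (y :: g))|apply/ce_wcons/IH].
Qed.

Lemma extp_ce_word s : extp (size s).-1 (ce_word s).
Proof.
apply: lspan_sum => j _; apply: lspan_sum => i ij; apply: lspanZ.
have -> : (size s).-1 = size (br s`_i s`_j :: del i (del j s)).
  have js := ltn_ord j; rewrite /= !size_del ?size_del //; lia.
exact: extp_wedge.
Qed.

Lemma two_sided_br J x y : two_sided J -> J x -> J (br x y).
Proof.
move=> Jt Jx; have [_ JD Jl Jr] := Jt; rewrite /br; apply: JD; first exact: Jr.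
by apply: (two_sidedN Jt); apply: Jl.
Qed.

Lemma ce_ce_d J r w : two_sided J -> ce J r.+2 w -> ce J r.+1 (ce_d w).
Proof.
move=> Jt; apply: lspan_map; first exact: ce_d_linear.
move=> _ [x [g [Jx gr ->]]]; rewrite ce_d_wedge ce_word_cons; apply: lspanD.
  apply: lspanN; apply: lspan_sum => j _; apply: lspanZ.
  have E : size (del j g) = r by rewrite size_del // gr.
  by have := ce_wedge (del j g) (two_sided_br g`_j Jt Jx); rewrite E.
apply: lspanN; apply: ce_wcons_ideal => //.
by have := extp_ce_word g; rewrite gr.
Qed.

(** A two-vector may lie in several [ce (J c) 2] through different expressions. To
    find a common one, let [e] be a unit in [J c] for the vectors of [J c] that
    occur in one expression: then [left_mul (1 - e)] kills the two-vector, so it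
    can be subtracted, which replaces [a ^ b] by [e a ^ b + (1 - e) a ^ e b]
    in any other expression and keeps what has been achieved for other [c]. *)
Lemma ce2_simultaneous (C : eqType) (J : C -> set A) (cs : seq C) w :
  (forall c, two_sided (J c)) -> (forall c, unital (J c)) ->
  extp 2 w -> (forall c, c \in cs -> ce (J c) 2 w) ->
  exists2 l : seq (A * A),
    forall (x : A * A) c, x \in l -> c \in cs -> J c x.1 \/ J c x.2
    & w = \sum_(x <- l) wedge [:: x.1; x.2].
Proof.
move=> Jt Ju w2; elim: cs => [|c cs IH] Jw.
  case: w2 => l lS ->; elim: l lS => [|[a v] l IHl] lS.
    by exists [::] => //; rewrite !big_nil.
  have [|m _ E] := IHl; first by move=> x xl; apply: lS; rewrite inE xl orbT.
  have [[|x [|y []]] // _ /= ->] := lS _ (mem_head _ _).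
  exists ((a *: x, y) :: m) => //; rewrite !big_cons E /=.
  by rewrite (linZ (wedge_cons_linear _)).
have [|l lJ lE] := IH; first by move=> d dcs; apply: Jw; rewrite inE dcs orbT.
have [e Je ew] : exists2 e, J c e & left_mul (1 - e) w = 0.
  have [m mS ->] := Jw _ (mem_head _ _).
  have [y hy] : exists y : k * ext A -> A * A, forall p, p \in m ->
      J c (y p).1 /\ p.2 = wedge [:: (y p).1; (y p).2].
    have : forall p : k * ext A, exists y : A * A, p \in m ->
        J c y.1 /\ p.2 = wedge [:: y.1; y.2].
      move=> p; case: (boolP (p \in m)) => [/mS h|]; last by exists (0, 0).
      have [y [g [Jy]]] : exists y g, [/\ J c y, size g = 1%N & p.2 = wedge (y :: g)].
        exact: h.
      by case: g => [|z []] // _ ->; exists (y, z).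
    by move=> /choice[y hy]; exists y.
  have [|e Je he] := Ju c [seq (y p).1 | p <- m].
    by move=> _ /mapP[p /hy[Jy _] ->].
  exists e => //; rewrite (lin_sum (left_mulL _)) big_seq big1 // => p pm.
  have [_ ->] := hy p pm; rewrite (linZ (left_mulL _)) left_mul_wedge /=.
  rewrite mulrBl mul1r he ?(map_f (fun p => (y p).1)) // subrr.
  by rewrite (lin0 (wedge_cons_linear _)) scaler0.
exists (flatten
  [seq [:: (e * x.1, x.2); ((1 - e) * x.1, e * x.2)] | x : A * A <- l]).
  move=> z d /flattenP[_ /mapP[x xl ->]]; rewrite !inE => zx dc.
  have [_ _ Jl _] := Jt d.
  have [_ _ _ Jr] := Jt c.
  case/orP: dc => [/eqP ->|dcs].
    by case/orP: zx => /eqP -> /=; [left|right]; apply: Jr.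
  by have [h|h] := lJ x d xl dcs; [left|right];
    case/orP: zx => /eqP -> //=; apply: Jl.
rewrite big_flatten big_map; transitivity (w - left_mul (1 - e) w).
  by rewrite ew subr0.
rewrite {1 2}lE (lin_sum (left_mulL _)) -sumrB.
apply: eq_bigr => x _; rewrite left_mul_wedge /= !big_cons big_nil addr0 /=.
have L z : linear (fun y => wedge [:: z; y]).
  by move=> a y y'; apply: (@wedge_linear _ _ [:: z]).
rewrite mulrBl mul1r !(linB (wedge_cons_linear _)) mulrBl mul1r !(linB (L _)).
by zmod_cancel.
Qed.

(** The projection to degree one, which recovers a vector from its image in the
    exterior algebra. *)
Definition letter : ext A -> A := plift (fun s => if s is [:: x] then x else 0).

Fact letter_rel r :
  @ext_rel k A r -> fglift (fun s : seq A => if s is [:: x] then x else 0) r = 0.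
Proof.
apply: ext_rel_lift => [[|z s] [|y' t] a x y|[|z [|z' s]] t x] //=;
  by rewrite ?scaler0 ?addr0 //; case: s => *; rewrite ?scaler0 ?addr0.
Qed.

Lemma letter1 x : letter (wedge [:: x]) = x.
Proof. exact: plift_gen letter_rel _. Qed.

Lemma wedge1_inj x y : wedge [:: x] = wedge [:: y] -> x = y.
Proof. by move=> /(congr1 letter); rewrite !letter1. Qed.

Lemma ce_d_wedge2 x y : ce_d (wedge [:: x; y]) = wedge [:: br y x].
Proof.
have d1 z : ce_d (wedge [:: z]) = 0.
  by rewrite ce_d_wedge /ce_word big_ord1 big_pred0_eq.
rewrite -wcons_wedge ce_d_wcons d1 (lin0 (wconsL x)) subr0 -wcons_wedge.
rewrite lie_wcons lie_nil (lin0 (wconsL y)) addr0 wcons_wedge brC.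
by rewrite (linN (wedge_cons_linear [::])) opprK.
Qed.

End ExtPower.

(** * The residue does not depend on the zigzag *)

Section Uniqueness.
Variables (k : fieldType) (n : nat).
Local Notation G := (Epow k n).

Definition ext_part r (Q : 'I_n -> bool -> bool) : set (ext G) :=
  [set w : ext G | extp r w /\ forall i b, Q i b -> ce (@Iat k n i b) r w].

Lemma ext_part0 r Q : ext_part r Q 0.
Proof.
split=> [|i b _]; first exact: lspan0.
by case: r => [|r]; exact: lspan0.
Qed.

Lemma ext_part_linear r Q a x y :
  ext_part r Q x -> ext_part r Q y -> ext_part r Q (a *: x + y).
Proof.
move=> [rx Qx] [ry Qy]; split=> [|i b h]; last by apply: ce_linear; auto.
by apply: lspanD => //; apply: lspanZ.
Qed.

Lemma ext_part_le r (Q Q' : 'I_n -> bool -> bool) x :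
  (forall i b, Q' i b -> Q i b) -> ext_part r Q x -> ext_part r Q' x.
Proof. by move=> QQ' [rx Qx]; split=> // i b /QQ'; apply: Qx. Qed.

Lemma ext_part_sub r Q x y :
  ext_part r Q x -> ext_part r Q y -> ext_part r Q (x - y).
Proof. exact: (Ysub (@ext_part_linear r)). Qed.

Lemma ext_part_ce_d r (Q : 'I_n -> bool -> bool) w :
  (forall i, exists b, Q i b) -> (0 < n)%N ->
  ext_part r.+2 Q w -> ext_part r.+1 Q (ce_d w).
Proof.
move=> Q1 n0 [_ Qw].
have h i b : Q i b -> ce (@Iat k n i b) r.+1 (ce_d w).
  by move=> /Qw; apply: ce_ce_d; apply: two_sided_Iat.
split=> // ; have [b Qb] := Q1 (Ordinal n0).
exact: ce_extp (h _ _ Qb).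
Qed.

Lemma sides_ex (s : signs n) i : exists b, sides s i b.
Proof.
by rewrite /sides; case: (s i) => [b|]; [exists b; rewrite eqxx|exists true].
Qed.

Lemma TcxP q r (f : {ffun signs n -> ext G}) : (0 < n)%N ->
  Tcx q r f <-> supported q f /\ in_parts (ext_part r) f.
Proof.
move=> n0; split=> [h|[hs hT] s].
  split=> [s sq|s]; first by have := h s; rewrite (negPf sq).
  have := h s; case: eqP => [_ X|_ ->]; last exact: ext_part0.
  have ceX i b : sides s i b -> ce (@Iat k n i b) r (f s).
    rewrite /sides; have := X i; case: (s i) => [c ch /eqP[<-] //|[]].
    by case: b.
  split=> // ; have [b Qb] := sides_ex s (Ordinal n0).
  exact: ce_extp (ceX _ _ Qb).
case: eqP => [_ i|/eqP sq]; last exact: hs.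
have [_ h] := hT s.
by case E: (s i) => [b|]; [|split]; apply: h; rewrite /sides E ?eqxx.
Qed.

Variable P : 'I_n -> G.
Hypothesis hP : good_idempotents P.

(** The splitting at place [i]. The two signs do not play symmetric roles: words
    all of whose letters are multiples of [P_i^-] lie on the minus side, and the
    complement of this projection lies on the plus side by [ce_sub_left_mul]. *)
Definition eproj i b (w : ext G) : ext G :=
  if b then w - left_mul (1 - P i) w else left_mul (1 - P i) w.

Lemma eprojL i b : linear (eproj i b).
Proof.
by case: b; [exact: linear_sub (@linear_id _ _) (left_mulL _)|exact: left_mulL].
Qed.

Lemma eprojD i w : eproj i true w + eproj i false w = w.
Proof. exact: subrK. Qed.

Lemma eproj_part r (Q : 'I_n -> bool -> bool) i b w :
  ext_part r.+1 Q w ->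
  ext_part r.+1 (fun j c => Q j c || (j == i) && (c == b)) (eproj i b w).
Proof.
have [_ _ into] := hP.
move=> [rw Qw]; split=> [|j c].
  case: b; last exact: extp_left_mul.
  by apply: lspanD => //; apply: lspanN; apply: extp_left_mul.
case/orP => [/Qw h|/andP[/eqP -> /eqP ->]].
  have hL : ce (@Iat k n j c) r.+1 (left_mul (1 - P i) w).
    apply: ce_left_mul => // x.
    by have [_ _ Jl _] := two_sided_Iat k n j c; apply: Jl.
  by case: b => //; rewrite /eproj -scaleN1r addrC; apply: ce_linear.
case: b; first by apply: ce_sub_left_mul => // x; rewrite subKr; apply: (into true).
by apply: ce_left_mul_into => // x; apply: (into false).
Qed.

Lemma bdE (f : {ffun signs n -> ext G}) s : bd f s = cbd f s.
Proof. by rewrite ffunE. Qed.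

Lemma bd1E (f : {ffun signs n -> ext G}) : bd1 f = caug f.
Proof. by []. Qed.

(** The [eta_m] are found by [eta_1 = sproj w] and
    [eta_(m+1) = htpys (th_m - ce_d eta_m)], where exactness applies to
    [th_m - ce_d eta_m] because [ce_d] squares to zero. At the last stage the
    complex is zero above, so the difference itself vanishes. *)
Lemma zigzag_boundary z th w : (0 < n)%N ->
  zigzag z th -> extp n.+2 w -> z = ce_d w ->
  exists2 eta, ext_part 2 (fun _ _ => true) eta & th n.+1 [ffun=> None] = ce_d eta.
Proof.
move=> n0 [thT th1 thd] w_ext zE.
have thT' m : (0 < m <= n.+1)%N ->
    supported m (th m) /\ in_parts (ext_part (n.+2 - m)) (th m).
  by move=> m1; apply/TcxP => //; apply: thT.
have step m : (0 < m <= n.+1)%N -> exists eta : signs n -> ext G,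
    [/\ supported m eta, in_parts (ext_part (n.+3 - m)) eta,
        forall s, cbd (fun t => th m t - ce_d (eta t)) s = 0
      & caug (fun t => th m t - ce_d (eta t)) = 0].
  elim: m => [//|[|m] IH] /andP[_ m1].
    exists (fun s => sproj eproj (enum 'I_n) s w).
    have [th1s _] : supported 1 (th 1%N) /\ _ := thT' 1%N isT.
    have w1 : supported 1 (fun s => sproj eproj (enum 'I_n) s w).
      by apply: sproj_supported1; exact: eprojL.
    split=> //.
    - apply: sproj_in_parts.
      + exact: ext_part0.
      + exact: ext_part_linear.
      + exact: ext_part_le.
      + exact: eproj_part.
      + by split.
    - move=> s; apply: cbd_supported1 => t t1.
      by rewrite th1s // w1 // (lin0 (@ce_d_linear _ _)) subr0.
    - rewrite caug_sub -bd1E th1 zE caug_sproj ?subrr //.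
      + exact: eprojL.
      + exact: eprojD.
      + exact: ce_d_linear.
  have [|eta [eta_s etaT etad etaa]] := IH; first exact: ltnW.
  have mn : (m.+1 <= n)%N by [].
  set g := fun t => _ in etad etaa.
  exists (htpys eproj (enum 'I_n) g).
  have [ths thiT] : supported m.+1 (th m.+1) /\ _ := thT' m.+1 (ltnW m1).
  have [ths' _] : supported m.+2 (th m.+2) /\ _ := thT' m.+2 m1.
  have gs : supported m.+1 g.
    by move=> t tm; rewrite /g ths // eta_s // (lin0 (@ce_d_linear _ _)) subr0.
  have hg : cbd (htpys eproj (enum 'I_n) g) =1 g.
    by apply: cube_exact => //; [exact: eprojL|exact: eprojD].
  have hs : supported m.+2 (htpys eproj (enum 'I_n) g).
    by apply: htpys_supported => //; exact: eprojL.
  split=> //.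
  - rewrite (_ : n.+3 - m.+2 = (n - m.+1).+2)%N; last by lia.
    apply: htpys_in_parts.
    + exact: eprojL.
    + exact: ext_part0.
    + exact: ext_part_linear.
    + exact: ext_part_le.
    + exact: eproj_part.
    move=> t; apply: ext_part_sub.
      by have := thiT t; rewrite (_ : n.+2 - m.+1 = (n - m.+1).+2)%N //; lia.
    apply: ext_part_ce_d => //; first exact: sides_ex.
    by have := etaT t; rewrite (_ : n.+3 - m.+1 = (n - m.+1).+3)%N //; lia.
  - move=> s; rewrite cbd_sub (cbd_lin _ _ (@ce_d_linear _ _)) hg /g.
    rewrite -bdE thd // ffunE (linB (@ce_d_linear _ _)) ce_d2 subr0 subrr //.
  - apply: (caug_supported (q := m.+2)) => // t tm.
    by rewrite ths' // hs // (lin0 (@ce_d_linear _ _)) subr0.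
have [|eta [eta_s etaT etad etaa]] := step n.+1; first by rewrite ltnS leqnn.
exists (eta [ffun=> None]).
  have := etaT [ffun=> None]; rewrite (_ : n.+3 - n.+1 = 2)%N; last by lia.
  by apply: ext_part_le => i b _; rewrite /sides ffunE.
have [ths _] : supported n.+1 (th n.+1) /\ _ := thT' n.+1 (leqnn _).
apply/eqP; rewrite -subr_eq0; apply/eqP.
rewrite -(cube_exact eprojL eprojD etad etaa [ffun=> None]) /cbd big1 // => i _.
rewrite (htpys_supported eprojL _ (q := n.+1)) ?scaler0 //.
  by move=> t tm; rewrite ths // eta_s // (lin0 (@ce_d_linear _ _)) subr0.
by apply: contraTneq (sdeg_le (upd [ffun=> None] i None)) => ->; rewrite ltnn.
Qed.

Lemma ext_part2_complementary w : (0 < n)%N -> ext_part 2 (fun _ _ => true) w ->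
  exists2 l : seq (G * G), forall x, x \in l -> complementary x.1 x.2
    & w = \sum_(x <- l) wedge [:: x.1; x.2].
Proof.
move=> n0 [w2 Jw].
have [||||l lJ ->] := @ce2_simultaneous _ _ ('I_n * bool)%type
    (fun c => @Iat k n c.1 c.2) (enum (('I_n * bool)%type : finType)) w.
- by move=> c; apply: two_sided_Iat.
- by move=> c; apply: unital_Iat.
- by [].
- by move=> c _; apply: Jw.
exists l => // x xl i s.
by apply: (lJ x (i, s) xl); rewrite mem_enum.
Qed.

Lemma zigzag_sub (z z' : ext G) (th th' : nat -> {ffun signs n -> ext G}) :
  zigzag z th -> zigzag z' th' ->
  (0 < n)%N -> zigzag (z - z') (fun i => th i - th' i).
Proof.
move=> [T1 d1 dd] [T1' d1' dd'] n0; split=> [i hi||i hi].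
- apply/TcxP => //; have [s1 Y1] := (TcxP _ _ _ n0).1 (T1 i hi).
  have [s2 Y2] := (TcxP _ _ _ n0).1 (T1' i hi); split=> s.
    by move=> si; rewrite !ffunE s1 ?s2 ?subr0.
  by rewrite !ffunE; apply: ext_part_sub.
- rewrite -d1 -d1' !bd1E -caug_sub; congr caug; apply/funext => s.
  by rewrite !ffunE.
apply/ffunP => s; have := congr1 (fun f : {ffun _} => f s) (dd i hi).
have := congr1 (fun f : {ffun _} => f s) (dd' i hi); rewrite !bdE !ffunE => E' E.
rewrite (linB (@ce_d_linear _ _)) -E -E' -cbd_sub; congr cbd; apply/funext => t.
by rewrite !ffunE.
Qed.

(** The difference of two zigzags starts at a boundary, so it ends in a sum of
    brackets of complementary matrices, whose trace is zero. *)
Lemma res_rel_unique h c c' :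
  (0 < n)%N -> @res_rel k n h c -> @res_rel k n h c' -> c = c'.
Proof.
move=> n0 [z [th [x [_ zh zz thx [xI <-]]]]].
move=> [z' [th' [x' [_ zh' zz' thx' [xI' <-]]]]].
have [w w_ext zw] : exists2 w, extp n.+2 w & z - z' = ce_d w.
  have : lspan (@bdry k G n.+1) (z - z').
    by apply/qpi_eq; apply: (etrans zh (esym zh')).
  case=> l lS ->; elim: l lS => [|y l IH] lS.
    exists 0; first exact: lspan0.
    by rewrite big_nil (lin0 (@ce_d_linear _ _)).
  have [|w w_ext wE] := IH; first by move=> t tl; apply: lS; rewrite inE tl orbT.
  have [v v_ext vE] : exists2 v, extp n.+2 v & ce_d v = y.2.
    exact: lS _ (mem_head _ _).
  exists (y.1 *: v + w); first by apply: lspanD => //; apply: lspanZ.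
  by rewrite big_cons ce_d_linear wE vE.
have [eta etaY] := zigzag_boundary n0 (zigzag_sub zz zz' n0) w_ext zw.
rewrite !ffunE thx thx' -(linB (wedge_cons_linear [::])).
have [l lC ->] := ext_part2_complementary n0 etaY.
have -> : ce_d (\sum_(y <- l) wedge [:: y.1; y.2]) =
    wedge [:: \sum_(y <- l) br y.2 y.1].
  rewrite (lin_sum (@ce_d_linear _ _)) (lin_sum (wedge_cons_linear [::])).
  by apply: eq_bigr => y _; apply: ce_d_wedge2.
move=> /wedge1_inj xx'; rewrite -[x](subrK x') xx' addrC.
elim: l lC {xx' etaY} => [|y l IH] lC; first by rewrite big_nil addr0.
have hy : complementary y.2 y.1 by apply/complementary_sym/lC/mem_head.
have lC' y' : y' \in l -> complementary y'.1 y'.2.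
  by move=> yl; apply: lC; rewrite inE yl orbT.
have J := Itr_two_sided k n; have [_ JD _ _] := J.
have brI (a b : G) : complementary a b -> Itr k n (br a b).
  move=> hab; rewrite /br; apply: (JD); first exact: Itr_complementary.
  by apply: (two_sidedN J); apply/Itr_complementary/complementary_sym.
rewrite big_cons addrCA tauD ?tau_br ?add0r ?IH //; first exact: brI.
apply: (JD) => //; elim: (l) lC' {IH} => [|t r IHr] lC'.
  by rewrite big_nil; case: J.
rewrite big_cons; apply: (JD).
  by apply: brI; apply/complementary_sym/lC'/mem_head.
by apply: IHr => y' yl; apply: lC'; rewrite inE yl orbT.
Qed.

End Uniqueness.

(** * Alternating sums over permutations *)

Section AlternatingSums.
Variables (k : fieldType) (A : algType k) (c : nat -> A -> A -> A).

(** For [c j a] the operator [P_j^- ad(a) P_j^+ - P_j^+ ad(a) P_j^-], this will be the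
    argument of the trace in the formula, at [q = n]. *)
Definition altsum q (x : A) (g : seq A) : A :=
  \sum_(p : 'S_q) (-1) ^+ p *: foldr (fun i : 'I_q => c i g`_(p i)) x (enum 'I_q).

Lemma altsum0 x g : altsum 0 x g = x.
Proof.
rewrite /altsum (big_pred1 1%g) => [|p].
  by rewrite odd_perm1 scale1r (size0nil (size_enum_ord 0)).
by apply/esym/eqP/permP => -[].
Qed.

Lemma nth_del_bump i (s : seq A) m : (del i s)`_m = s`_(bump i m).
Proof.
rewrite /bump; case: leqP => im; last by rewrite nth_del.
have [is_|si] := ltnP i (size s).
  rewrite /del nth_cat size_take is_ ltnNge im /= nth_drop; congr _`_(_); lia.
by rewrite !nth_default // ?size_cat ?size_take ?size_drop ?(ltnNge i) ?si /=; lia.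
Qed.

Lemma lift_perm_ex q (s : 'S_q.+1) i :
  s ord_max = i -> exists p, lift_perm ord_max i p = s.
Proof.
move=> si; pose f j := odflt j (unlift i (s (fintype.lift ord_max j))).
have fE j : fintype.lift i (f j) = s (fintype.lift ord_max j).
  rewrite /f; case: unliftP => [//|]; rewrite -si => /perm_inj /eqP.
  by rewrite eq_sym (negPf (neq_lift _ _)).
have f_inj : injective f.
  by move=> j j' /(congr1 (fintype.lift i)); rewrite !fE => /perm_inj /lift_inj.
exists (perm f_inj); apply/permP => j; case: (unliftP ord_max j) => [j' ->|->].
  by rewrite lift_perm_lift permE fE.
by rewrite lift_perm_id.
Qed.

(** The permutations are sorted by the letter that is fed to the innermost operator
    [c q], as in the expansion of a determinant along its last row. *)
Lemma altsumS q x g : size g = q.+1 -> altsum q.+1 x g =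
  \sum_(i < q.+1) (-1) ^+ (q + i) *: altsum q (c q g`_i x) (del i g).
Proof.
move=> gq; rewrite /altsum.
rewrite (partition_big (fun p : 'S_q.+1 => p ord_max) predT) //=.
apply: eq_bigr => i _; rewrite scaler_sumr.
rewrite -big_set (_ : [set _ | _] = [set lift_perm ord_max i p | p in 'S_q]);
  last first.
  apply/setP => s; rewrite inE; apply/idP/imsetP => [/eqP si|[p _ ->]].
    by have [p <-] := lift_perm_ex (val_inj si); exists p.
  by apply/eqP; rewrite lift_perm_id.
rewrite big_imset => [|p p' _ _ /permP pp'] /=; last first.
  apply/permP => j; have := pp' (fintype.lift ord_max j).
  by rewrite !lift_perm_lift => /lift_inj.
apply: eq_big => [p|p _]; first by rewrite !inE.
rewrite scalerA enum_ordSr foldr_rcons lift_perm_id foldr_map; congr (_ *: _).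
  by rewrite odd_lift_perm !signr_addb !signr_odd -exprD.
suff E (j : 'I_q) z : c (widen_ord (leqnSn q) j)
      g`_(lift_perm ord_max i p (widen_ord (leqnSn q) j)) z = c j (del i g)`_(p j) z.
  by elim: (enum 'I_q) => //= j r ->; apply: E.
have -> : widen_ord (leqnSn q) j = fintype.lift ord_max j.
  by apply: val_inj; rewrite /= /bump leqNgt ltn_ord.
rewrite lift_perm_lift nth_del_bump /=.
by rewrite /bump leqNgt ltn_ord.
Qed.

End AlternatingSums.

(** * The zigzag in the complex with adjoint coefficients *)

Section Existence.
Variables (k : fieldType) (n : nat).
Local Notation G := (Epow k n).
Local Notation T := (tensor G (ext G)).
Variable P : 'I_n -> G.
Hypothesis hP : good_idempotents P.

Definition tens_mul u : T -> T := plift (fun p => tens (u * p.1) p.2).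

Fact tens_mul_rel u r : @tens_rel k G (ext G) r ->
  fglift (fun p : G * ext G => tens (u * p.1) p.2) r = 0.
Proof.
apply: tens_rel_lift => [w|x] /=; last exact: tens_linear.
by move=> a x y; rewrite mulrDr -scalerAr tens_linearl.
Qed.

Lemma tens_mulL u : linear (tens_mul u).
Proof. exact: plift_linear (@tens_mul_rel u). Qed.

Lemma tens_mul_tens u x w : tens_mul u (tens x w) = tens (u * x) w.
Proof. exact: plift_gen (@tens_mul_rel u) _. Qed.

Definition tproj i b : T -> T := tens_mul (idem P b i).

Lemma tprojL i b : linear (tproj i b). Proof. exact: tens_mulL. Qed.

Lemma tprojD i u : tproj i true u + tproj i false u = u.
Proof.
move: u; apply: tensor_eq => [||x w]; first exact: linear_add (tprojL _ _) (tprojL _ _).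
  exact: linear_id.
rewrite /tproj !tens_mul_tens -(linD (tens_linearl w)) /= -mulrDl.
by rewrite addrC subrK mul1r.
Qed.

(** The coefficient is required to lie in all the ideals of [Q] at once, so no
    intersection of subspaces occurs here. *)
Definition tensor_part r (Q : 'I_n -> bool -> bool) : set T :=
  lspan [set u : T | exists x g, [/\ size g = r, u = tens x (wedge g)
                                & forall i b, Q i b -> @Iat k n i b x]].

Lemma tensor_part0 r Q : tensor_part r Q 0. Proof. exact: lspan0. Qed.

Lemma tensor_part_linear r Q a u v :
  tensor_part r Q u -> tensor_part r Q v -> tensor_part r Q (a *: u + v).
Proof. by move=> hu; apply: lspanD; apply: lspanZ. Qed.

Lemma tensor_part_le r (Q Q' : 'I_n -> bool -> bool) u :
  (forall i b, Q' i b -> Q i b) -> tensor_part r Q u -> tensor_part r Q' u.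
Proof.
move=> QQ'; apply: (@lspan_map _ _ _ _ _ id) => // _ [x [g [gr -> xQ]]].
by apply: sub_lspan; exists x, g; split=> // i b /QQ'; apply: xQ.
Qed.

Lemma tproj_part r (Q : 'I_n -> bool -> bool) i b u :
  tensor_part r Q u ->
  tensor_part r (fun j c => Q j c || (j == i) && (c == b)) (tproj i b u).
Proof.
have [_ _ into] := hP.
apply: lspan_map; first exact: tprojL.
move=> _ [x [g [gr -> xQ]]]; apply: sub_lspan; exists (idem P b i * x), g.
split=> //; first exact: tens_mul_tens.
move=> j c; case/orP => [/xQ h|/andP[/eqP -> /eqP ->]]; last exact: into.
by have [_ _ Jl _] := two_sided_Iat k n j c; apply: Jl.
Qed.

Lemma tensor_part_adj_d r Q u : tensor_part r.+1 Q u -> tensor_part r Q (adj_d u).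
Proof.
apply: lspan_map; first exact: adj_d_linear.
move=> _ [x [g [gr -> xQ]]]; rewrite adj_dE adbr_wedge ce_d_wedge.
have h y w : (forall i b, Q i b -> @Iat k n i b y) -> extp r w ->
    tensor_part r Q (tens y w).
  move=> yQ; apply: lspan_map; first exact: tens_linear.
  by move=> _ [s sr ->]; apply: sub_lspan; exists y, s.
apply: lspanD; apply: lspanN; last first.
  by apply: h => //; have := extp_ce_word g; rewrite gr.
apply: lspan_sum => j _; apply: lspanZ; apply: h.
  by move=> i b /xQ; apply: two_sided_br; apply: two_sided_Iat.
have E : size (del j g) = r by rewrite size_del // gr.
by have := extp_wedge (del j g); rewrite E.
Qed.

Lemma mu_part r Q u : tensor_part r Q u -> ext_part r.+1 Q (mu u).
Proof.
move=> uQ; split=> [|i b Qib]; move: uQ; apply: lspan_map; try exact: muL.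
  move=> _ [x [g [<- -> _]]]; rewrite mu_tens wcons_wedge.
  exact: (extp_wedge (x :: g)).
move=> _ [x [g [<- -> xQ]]]; rewrite mu_tens wcons_wedge.
by apply: ce_wedge; apply: xQ.
Qed.

Variables (f0 : G) (f : n.-tuple G).
Hypothesis hcycle : adj_d (tens f0 (wedge f)) = 0.

(** [tzigzag m] has degree [m + 1] in the complex: the index is the number of
    contractions that have been applied. *)
Fixpoint tzigzag m : signs n -> T :=
  if m is m'.+1 then htpys tproj (enum 'I_n) (fun s => adj_d (tzigzag m' s))
  else fun s => sproj tproj (enum 'I_n) s (tens f0 (wedge f)).

Lemma tzigzag_supported m : supported m.+1 (tzigzag m).
Proof.
elim: m => [|m IH] /=; first by apply: sproj_supported1; exact: tprojL.
apply: htpys_supported; first exact: tprojL.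
by move=> s sm; rewrite IH // (lin0 (@adj_d_linear _ _)).
Qed.

Lemma tzigzag_in_parts m : (m <= n)%N -> in_parts (tensor_part (n - m)) (tzigzag m).
Proof.
elim: m => [|m IH] mn /=.
  apply: sproj_in_parts; [exact: tensor_part0|exact: tensor_part_linear
    |exact: tensor_part_le|exact: tproj_part|].
  by rewrite subn0; apply: sub_lspan; exists f0, f; rewrite size_tuple.
apply: htpys_in_parts; [exact: tprojL|exact: tensor_part0|exact: tensor_part_linear
  |exact: tensor_part_le|exact: tproj_part|].
move=> s; apply: tensor_part_adj_d.
by have := IH (ltnW mn) s; rewrite (_ : n - m = (n - m.+1).+1)%N //; lia.
Qed.

(** Exactness applies to [adj_d (tzigzag m)] because [adj_d] squares to zero; for
    [m = 0], its augmentation is the differential of the initial cycle. *)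
Lemma cbd_tzigzag m : cbd (tzigzag m.+1) =1 (fun s => adj_d (tzigzag m s)).
Proof.
elim: m => [|m IH]; apply: cube_exact; try exact: tprojL; try exact: tprojD.
- move=> s; rewrite (cbd_lin _ _ (@adj_d_linear _ _)) cbd_supported1;
    last exact: (tzigzag_supported (m := 0)).
  exact: (lin0 (@adj_d_linear _ _)).
- rewrite (caug_sproj tprojL tprojD) ?hcycle //; exact: adj_d_linear.
- move=> s; rewrite (cbd_lin _ _ (@adj_d_linear _ _)) IH.
  exact: adj_d2.
- apply: (caug_supported (q := m.+2)) => // s sm.
  rewrite -[LHS]/(adj_d (tzigzag m.+1 s)) tzigzag_supported //.
  exact: (lin0 (@adj_d_linear _ _)).
Qed.

Lemma tzigzag_zigzag : (0 < n)%N ->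
  zigzag (wedge (f0 :: f)) (fun m => [ffun s => mu (tzigzag m.-1 s)]).
Proof.
move=> n0; split=> [[//|m] /andP[_ mn]||[//|m] /andP[_ mn]] /=.
- apply/TcxP => //; split=> s; rewrite ffunE.
    by move=> sm; rewrite tzigzag_supported // (lin0 (@muL _ _)).
  have := mu_part (tzigzag_in_parts mn s).
  by rewrite (_ : n.+2 - m.+1 = (n - m).+1)%N //; lia.
- rewrite bd1E (_ : caug _ = caug (fun s => mu (tzigzag 0 s))); last first.
    by congr caug; apply/funext => s; rewrite ffunE.
  rewrite (caug_lin _ (@muL _ _)).
  have := caug_sproj tprojL tprojD (tens f0 (wedge f)) (@linear_id _ _) => /= ->.
  by rewrite mu_tens wcons_wedge.
- apply/ffunP => s; rewrite bdE [RHS]ffunE [in RHS]ffunE -mu_adj_d -cbd_tzigzag.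
  rewrite -(cbd_lin _ _ (@muL _ _)); congr cbd; apply/funext => t.
  by rewrite ffunE.
Qed.

End Existence.

(** * The end of the zigzag *)

Section Evaluation.
Variables (k : fieldType) (n : nat).
Local Notation G := (Epow k n).
Local Notation T := (tensor G (ext G)).
Variable P : 'I_n -> G.
Hypothesis hP : good_idempotents P.
Local Notation tp := (tproj P).

Definition contr (i : 'I_n) (a x : G) : G :=
  idem P false i * br a (idem P true i * x)
  - idem P true i * br a (idem P false i * x).

(** [altsum] takes operators indexed by [nat]; only the indices below [n] occur. *)
Definition contr_nat (j : nat) (a x : G) : G :=
  if insub j is Some i then contr i a x else 0.

Lemma contr_natE (i : 'I_n) a x : contr_nat i a x = contr i a x.
Proof. by rewrite /contr_nat valK. Qed.

Definition tcontr i (u : T) : T :=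
  tp i false (adj_d (tp i true u)) - tp i true (adj_d (tp i false u)).

Lemma tcontrL i : linear (tcontr i).
Proof.
have h b c : linear (fun u => tp i b (adj_d (tp i c u))).
  exact: linear_comp (tprojL P i b) (linear_comp (@adj_d_linear _ _) (tprojL P i c)).
exact: linear_sub (h false true) (h true false).
Qed.

Lemma idem_orth b i : idem P b i * idem P (~~ b) i = 0.
Proof.
have [_ PP _] := hP.
by case: b; rewrite /= ?mulrBr ?mulrBl ?mulr1 ?mul1r PP subrr.
Qed.

(** The part of [adj_d] that leaves [x] alone commutes with the projections, so
    it disappears between [P_i^-] and [P_i^+]. *)
Lemma tcontr_tens i x g : tcontr i (tens x (wedge g)) =
  \sum_(j < size g) (-1) ^+ j *: tens (contr i g`_j x) (wedge (del j g)).
Proof.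
have h b : tp i b (adj_d (tp i (~~ b) (tens x (wedge g)))) =
    \sum_(j < size g) (-1) ^+ j *:
      tens (idem P b i * br g`_j (idem P (~~ b) i * x)) (wedge (del j g)).
  rewrite /tproj tens_mul_tens adj_dE (linB (tens_mulL _)) (linN (tens_mulL _)).
  rewrite tens_mul_tens.
  rewrite mulrA idem_orth mul0r (lin0 (tens_linearl _)) subr0 adbr_wedge.
  rewrite (lin_sum (tens_mulL _)) -sumrN; apply: eq_bigr => j _.
  rewrite (linZ (tens_mulL _)) tens_mul_tens -scalerN -(linN (tens_linearl _)).
  by rewrite -mulrN -brC.
rewrite /tcontr (h false) (h true) -sumrB; apply: eq_bigr => j _.
by rewrite -scalerBr -tensBl.
Qed.

Definition tcontr_nat (j : nat) (u : T) : T :=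
  if insub j is Some i then tcontr i u else 0.

Lemma tcontr_natE (i : 'I_n) u : tcontr_nat i u = tcontr i u.
Proof. by rewrite /tcontr_nat valK. Qed.

Lemma tcontr_natL j : linear (tcontr_nat j).
Proof.
by rewrite /tcontr_nat; case: insub => [i|]; [exact: tcontrL|exact: linear_zero].
Qed.

(** The exponent [n - q] is the number of places after place [q - 1]; it gives the
    sign of the contraction at that place once all later signs are zero. *)
Fixpoint tcontrs q (u : T) : T :=
  if q is q'.+1 then tcontrs q' ((-1) ^+ (n - q) *: tcontr_nat q' u) else u.

Lemma tcontrsL q : linear (tcontrs q).
Proof.
elim: q => [|q IH]; first exact: linear_id.
exact: linear_comp IH (linear_scale _ (tcontr_natL q)).
Qed.

(** Each step has the sign [(-1)^(n - 1 - q)] of the contraction, and [altsumS] has the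
    sign [(-1)^q] of moving a letter to the end of the word; together they are
    [(-1)^(n - 1)] at every step. *)
Lemma tcontrs_tens q x g : (q <= n)%N -> size g = q -> tcontrs q (tens x (wedge g)) =
  (-1) ^+ (n.-1 * q) *: tens (altsum contr_nat q x g) (wedge [::]).
Proof.
elim: q x g => [|q IH] x g qn gq.
  by rewrite (size0nil gq) altsum0 muln0 scale1r.
rewrite /= -[q]/(val (Ordinal qn)) tcontr_natE tcontr_tens /=.
rewrite (linZ (tcontrsL q)) (lin_sum (tcontrsL q)) altsumS // gq.
rewrite (lin_sum (tens_linearl _)) !scaler_sumr; apply: eq_bigr => j _.
rewrite (linZ (tcontrsL q)) IH ?size_del ?gq //; last exact: ltnW.
rewrite (linZ (tens_linearl _)) !scalerA -!exprD; congr (_ *: tens _ _); last first.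
  by rewrite -(contr_natE (Ordinal qn)).
rewrite -[LHS]signr_odd -[RHS]signr_odd; congr (_ ^+ nat_of_bool _).
rewrite !(oddD, oddM) /=.
have -> : odd (n - q.+1) = odd n.-1 (+) odd q.
  by rewrite -oddB; [congr odd|]; lia.
by case: (odd n.-1); case: (odd q); case: (odd j).
Qed.

Lemma zeros_after_tail (t : signs n) (q : 'I_n) :
  (forall j : 'I_n, (q < j)%N -> t j = None) -> zeros_after t q = (n - q.+1)%N.
Proof.
move=> tN; have := cardC [pred j : 'I_n | (q < j)%N && (t j == None)].
rewrite card_ord -[X in (X + _)%N]/(zeros_after t q).
have -> : #|[predC [pred j : 'I_n | (q < j)%N && (t j == None)]]| = q.+1.
  rewrite -sum1_card -[RHS]card_ord -[RHS]sum1_card.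
  rewrite (eq_bigl (fun j : 'I_n => (j < q.+1)%N)) => [|j].
    by rewrite (big_ord_narrow (ltn_ord q)).
  rewrite !inE ltnS; have [qj|//] := ltnP q j.
  by rewrite tN.
by move=> E; lia.
Qed.

Variables (f0 : G) (f : n.-tuple G).

(** At a component with zeros exactly at the last [m + 1] places, [htpys] only reads
    components with zeros exactly at the last [m] places ([htpys_first_zero]).
    By induction these are sections of one element [y] at the other places,
    and [augs_sproj] sums these sections away across [adj_d]. *)
Lemma tzigzag_path m : (m <= n)%N -> exists2 y,
  tcontrs (n - m) y = tcontrs n (tens f0 (wedge f)) &
  forall s : signs n, (forall j : 'I_n, (s j == None) = (n - m <= j)%N) ->
    tzigzag P f0 f m s = sproj tp (take (n - m) (enum 'I_n)) s y.
Proof.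
elim: m => [|m IH] mn.
  exists (tens f0 (wedge f)) => [|s _]; first by rewrite subn0.
  by rewrite subn0 take_oversize // size_enum_ord.
have [|y yE yP] := IH; first exact: ltnW.
have nm : (n - m = (n - m.+1).+1)%N by lia.
have qn : (n - m.+1 < n)%N by lia.
pose q := Ordinal qn; pose l := take (n - m.+1) (enum 'I_n).
have enumE : enum 'I_n = l ++ q :: drop (n - m) (enum 'I_n).
  rewrite -{1}(cat_take_drop (n - m.+1) (enum 'I_n)); congr (_ ++ _).
  rewrite (drop_nth q) ?size_enum_ord // -nm; congr (_ :: _).
  by apply: val_inj; rewrite /= nth_enum_ord.
have takeE : take (n - m) (enum 'I_n) = rcons l q.
  rewrite nm (take_nth q) ?size_enum_ord //; congr rcons.
  by apply: val_inj; rewrite /= nth_enum_ord.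
have ul : uniq l by apply/take_uniq/enum_uniq.
have lP (j : 'I_n) : (j \in l) = (j < n - m.+1)%N.
  by rewrite /l in_take ?mem_enum // index_enum_ord.
have ql : q \notin l by rewrite lP ltnn.
exists ((-1) ^+ m *: tcontr q y).
  rewrite -yE nm /= -(tcontr_natE q) /=; congr (tcontrs _ (_ ^+ _ *: _)).
  by lia.
move=> s sP; rewrite -/l.
transitivity (htpys tp (enum 'I_n) (fun t => adj_d (tzigzag P f0 f m t)) s);
  first by [].
rewrite enumE htpys_first_zero; last first.
- by move=> j; rewrite lP sP -ltnNge.
- by apply/eqP; rewrite sP.
rewrite (aprojsE (tprojL P)) //; congr sproj.
pose Phi b v := (-1) ^+ m *: tp q b (adj_d v).
have PhiL b : linear (Phi b).
  exact: linear_scale (linear_comp (tprojL P q b) (@adj_d_linear _ _)).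
transitivity (augs l (fun t => Phi false (sproj tp l t (tp q true y))
                        - Phi true (sproj tp l t (tp q false y))) s); last first.
  rewrite augs_sub.
  rewrite (augs_sproj (tprojL P) (tprojD P) (Phi := fun=> Phi false)) //;
    last by move=> _; apply: PhiL.
  rewrite (augs_sproj (tprojL P) (tprojD P) (Phi := fun=> Phi true)) //;
    last by move=> _; apply: PhiL.
  by rewrite /Phi -scalerBr.
apply: augs_ext => t tl ts.
have tq : t q = None by apply/eqP; rewrite ts // sP.
have tN (j : 'I_n) : (q < j)%N -> t j = None.
  move=> qj; apply/eqP; rewrite ts ?sP; first exact: ltnW.
  by rewrite lP -leqNgt; apply: ltnW.
have tzigzagE b :
    tzigzag P f0 f m (upd t q (Some b)) = sg k b *: sproj tp l t (tp q b y).
  rewrite yP => [|j].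
    rewrite takeE /sproj foldr_rcons upd_at -/(sproj _ _ _ _) sproj_upd //.
    by rewrite (linZ (sprojL (tprojL P) l t)).
  rewrite updE; case: (eqVneq j q) => [->|jq]; first by rewrite nm /= ltnn.
  rewrite nm; have [jl|lj] := ltnP (n - m.+1) j; first by rewrite tN.
  have jl : j \in l by rewrite lP ltn_neqAle lj andbT.
  by rewrite (negPf (tl j jl)).
rewrite /htpy tq /sgn zeros_after_tail // !tzigzagE scale1r scaleN1r.
rewrite (linN (@adj_d_linear _ _)) (linN (tprojL P q true)) scalerBr.
by rewrite /Phi; congr (_ ^+ _ *: _ - _ ^+ _ *: _); rewrite /=; lia.
Qed.

Lemma tzigzag_end : tzigzag P f0 f n [ffun=> None] =
  tens (altsum contr_nat n f0 f) (wedge [::]).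
Proof.
have [y yE yP] := tzigzag_path (leqnn n).
rewrite yP => [|j]; last by rewrite ffunE subnn.
move: yE; rewrite subnn take0 /= => ->.
have E m : odd m.-1 && odd m = false by case: m => //= m; rewrite andbN.
by rewrite tcontrs_tens ?size_tuple // -signr_odd oddM E scale1r.
Qed.

(** The operator at place [i] multiplies a bracket of an element of [I_i^s] by
    [P_i^(-s)], so its values lie in both ideals at [i]; the operators that
    follow preserve this. *)
Lemma altsum_Itr : Itr k n (altsum contr_nat n f0 f).
Proof.
move=> i b; have [J0 JD Jl Jr] := two_sided_Iat k n i b.
have [_ _ into] := hP.
have JZ a x : @Iat k n i b x -> @Iat k n i b (a *: x).
  by move=> h; rewrite -[x]mul1r scalerAl; apply: Jl.
apply: two_sided_sum => [|p _]; first exact: two_sided_Iat.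
apply: JZ; have : i \in enum 'I_n by rewrite mem_enum.
elim: (enum 'I_n) => //= j l IH; rewrite contr_natE /contr inE.
set x := foldr _ _ _ in IH *; set a := f`_(p j).
have JB c y z : @Iat k n i b y -> @Iat k n i b (c * br z y).
  move=> h; rewrite brC; apply/Jl/(two_sidedN (two_sided_Iat k n i b)).
  by apply: two_sided_br => //; apply: two_sided_Iat.
have two y z : @Iat k n i b y -> @Iat k n i b z -> @Iat k n i b (y - z).
  by move=> hy hz; apply: JD => //; apply: (two_sidedN (two_sided_Iat k n i b)).
case/predU1P => [ij|/IH h]; last by apply: two; apply/JB/Jl.
rewrite -ij; apply: two; case: (b) into JB => into JB.
- by apply/JB; apply: (into true).
- exact: (into false).
- exact: (into true).
- by apply/JB; apply: (into false).
Qed.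

Lemma altsum_contr :
  altsum contr_nat n f0 f =
  \sum_(p : 'S_n) (-1) ^+ p *:
    \sum_(g : {ffun 'I_n -> bool}) (\prod_i sg k (g i)) *:
      foldr (fun (i : 'I_n) (x : G) =>
               idem P (~~ g i) i * br (tnth f (p i)) (idem P (g i) i * x))
            f0 (enum 'I_n).
Proof.
apply: eq_bigr => p _; congr (_ *: _).
pose op i b (x : G) := idem P (~~ b) i * br (tnth f (p i)) (idem P b i * x).
have opL i b : linear (op i b).
  move=> a x y; rewrite /op (mulrDr _ (a *: x)) -scalerAr br_linear.
  by rewrite (mulrDr _ (a *: _)) -scalerAr.
have E (i : 'I_n) x :
    contr_nat i f`_(p i) x = sg k true *: op i true x + sg k false *: op i false x.
  by rewrite contr_natE -tnth_nth scale1r scaleN1r.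
rewrite (_ : foldr _ _ _ =
    foldr (fun i x => sg k true *: op i true x + sg k false *: op i false x) f0
      (enum 'I_n));
  last by elim: (enum 'I_n) => //= i l ->; rewrite E.
rewrite (foldr_sum_choices (op := fun i b x => sg k b *: op i b x)) => [|i b x y].
  apply: eq_bigr => g _; rewrite -big_enum /=.
  elim: (enum 'I_n) => [|i l IH] /=; first by rewrite big_nil scale1r.
  by rewrite big_cons IH (linZ (opL _ _)) scalerA.
by rewrite (linD (opL i b)) scalerDr.
Qed.

End Evaluation.

Theorem theorem2 (k : fieldType) (n : nat) (hn : (1 <= n)%N)
    (P : 'I_n -> Epow k n) (hP : good_idempotents P)
    (f0 : Epow k n) (f : n.-tuple (Epow k n))
    (hcycle : adj_d (tens f0 (wedge f)) = 0) :
  tate_class (wedge (f0 :: f)) =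
  tau (\sum_(p : 'S_n) (-1) ^+ p *:
         \sum_(g : {ffun 'I_n -> bool}) (\prod_i sg k (g i)) *:
           foldr (fun (i : 'I_n) (x : Epow k n) =>
                    idem P (~~ g i) i * br (tnth f (p i)) (idem P (g i) i * x))
                 f0 (enum 'I_n)).
Proof.
rewrite -altsum_contr; set x := altsum _ _ _ _.
have rel : @res_rel k n (hcl n.+1 (wedge (f0 :: f))) (tau x).
  exists (wedge (f0 :: f)), (fun m => [ffun s => mu (tzigzag P f0 f m.-1 s)]), x.
  split=> //.
  - split; first by have := extp_wedge (f0 :: f); rewrite /= size_tuple.
    by rewrite -wcons_wedge -mu_tens -mu_adj_d hcycle (lin0 (@muL _ _)).
  - exact: tzigzag_zigzag.
  - by rewrite ffunE /= tzigzag_end // mu_tens wcons_wedge.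
  - by split=> //; apply: altsum_Itr.
apply: (res_rel_unique hP hn _ rel).
have ex : exists c, [set c | res_rel (hcl n.+1 (wedge (f0 :: f))) c]%classic c.
  by exists (tau x).
exact: (xgetPex 0 ex).
Qed.
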